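(* Let $q$ be a prime power, $n$ a positive integer, $0<t\le n$ an integer and $b=1+q^t$. Assume that the polynomial $\mathrm{Tr}_b(X)$ has $m=q^{2n-1-t}+q^{2n-1}$ different roots in $\mathbb{F}_{q^{2n}}$. Define, for $q\neq 2$, $$A(q,t):=\begin{cases} q^n-\lceil\frac{q-1}{2}\rceil q^{n-1}-\lceil\frac{q-1}{2}\rceil q^{n-t-1}-2 & \text{if } 0<t\le \frac n2,\\ q^n-\lceil\frac{q-1}{2}\rceil q^{n-1}-\lceil\frac{q-1}{2}\rceil q^{t-1}-2 & \text{if } \frac n2<t<n,\\ q^{n-1}-2 & \text{if } t=n,\end{cases}$$ and, for $q=2$, $$A(q,t):=\begin{cases}2^n-2^{t-1}-2 & \text{if } t<n,\\ 2^{n-1}-2 & \text{if } t=n.\end{cases}$$ Then, for each nonnegative integer $\tau\le A(q,t)$, there is a stabilizer quantum code with parameters $$[[q^{2n-1-t}+q^{2n-1},\ q^{2n-1-t}+q^{2n-1}-2\tau-2,\ \ge\tau+2]]_{q^n}.$$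
   Context: For a positive integer $j$ put $\mathrm{tr}_j(X)=X+X^q+\cdots+X^{q^{j-1}}$. For $b=1+q^t$ with $0<t\le n$, let $P_b(X)=1+\mathrm{tr}_{2n}(X^b)$ if $0<t<n$, and $P_b(X)=1+\mathrm{tr}_n(X^b)$ if $t=n$. The $b$th trace-depending polynomial $\mathrm{Tr}_b(X)\in\mathbb{F}_{q^{2n}}[X]$ is the representative of minimum degree of the class of $P_b(X)$ in $\mathbb{F}_{q^{2n}}[X]/\langle X^{q^{2n}-1}-1\rangle$. For a prime power $Q$, a stabilizer quantum code is a nonzero subspace of $\mathbb{C}^{Q^N}$ which is the intersection of the eigenspaces with eigenvalue $1$ of the elements of an abelian subgroup of the error group generated by a suitable (standard) error basis on $\mathbb{C}^{Q^N}$; it has parameters $[[N,K,d]]_Q$ if it has dimension $Q^K$ and minimum distance $d$. The symbol ''$\ge x$'' in the distance position means that the minimum distance is at least $x$. *)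

(* Defs.v *)
From HB Require Import structures.
From mathcomp Require Import all_boot all_order all_algebra all_field.
From mathcomp Require Import complex reals trigo.

Set Implicit Arguments.
Unset Strict Implicit.
Unset Printing Implicit Defensive.

Import Order.TTheory GRing.Theory Num.Theory.
Local Open Scope ring_scope.

Definition prime_power (q : nat) : Prop :=
  exists p k : nat, [/\ prime p, (0 < k)%N & q = (p ^ k)%N].

Definition tr_poly (L : fieldType) (q j : nat) (f : {poly L}) : {poly L} :=
  \sum_(i < j) f ^+ (q ^ i).

Definition P_poly (L : fieldType) (q n t : nat) : {poly L} :=
  1 + tr_poly q (if t == n then n else (2 * n)%N) 'X^(1 + q ^ t).

(** Over a field, the minimum-degree representative of a class modulo a nonzero
    polynomial is the remainder of the Euclidean division. *)
Definition Tr_poly (L : fieldType) (q n t : nat) : {poly L} :=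
  P_poly L q n t %% ('X^(q ^ (2 * n) - 1) - 1).

(** [uphalf (q - 1)] is the ceiling of (q - 1) / 2; the natural number
    subtractions occur only in exponents, where they are never truncated for
    0 < t <= n. *)
Definition A_bound (q n t : nat) : int :=
  if q == 2 then
    if (t < n)%N then (2 ^ n)%N%:Z - (2 ^ (t - 1))%N%:Z - 2
    else (2 ^ (n - 1))%N%:Z - 2
  else
    let c := (uphalf (q - 1))%:Z in
    if (2 * t <= n)%N then
      (q ^ n)%N%:Z - c * (q ^ (n - 1))%N%:Z - c * (q ^ (n - t - 1))%N%:Z - 2
    else if (t < n)%N then
      (q ^ n)%N%:Z - c * (q ^ (n - 1))%N%:Z - c * (q ^ (t - 1))%N%:Z - 2
    else (q ^ (n - 1))%N%:Z - 2.

(** C^(Q^N) for Q = #|F|, with standard orthonormal basis indexed by the vectors of F^N. *)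
Notation state_space R F N := {ffun 'rV[F]_N -> (R[i])^o}.

Definition hdot (R : realType) (F : finFieldType) (N : nat)
    (u v : state_space R F N) : R[i] :=
  \sum_x (u x)^* * v x.

(** The characteristic of F. *)
Definition field_char (F : finFieldType) : nat := pdiv #|F|.

(** The absolute trace F -> F_p. *)
Definition abs_trace (F : finFieldType) (x : F) : F :=
  \sum_(i < logn (field_char F) #|F|) x ^+ (field_char F ^ i).

(** Its value, an element of the prime subfield, read in {0, ..., p - 1}. *)
Definition abs_trace_nat (F : finFieldType) (x : F) : nat :=
  if [pick k : 'I_(field_char F) | (k : nat)%:R == abs_trace x] is Some k
  then k else 0%N.

(** exp(2 i pi / p). *)
Definition omega (R : realType) (p : nat) : R[i] :=
  Complex (cos (2 * pi / p%:R)) (sin (2 * pi / p%:R)).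

(** Generator of the phases of the error group: omega for odd p, and the
    imaginary unit for p = 2, where it is needed for the group to contain the
    self-adjoint Pauli operator Y = i X Z. *)
Definition phase (R : realType) (p : nat) : R[i] :=
  if p == 2 then Complex 0 1 else omega R p.

Definition dotv (F : finFieldType) (N : nat) (b x : 'rV[F]_N) : F :=
  \sum_(i < N) b 0 i * x 0 i.

(** The basis change |x> |-> |x + a>, written on coordinates. *)
Definition shift_fun (R : realType) (F : finFieldType) (N : nat) (a : 'rV[F]_N)
    (v : state_space R F N) : state_space R F N :=
  [ffun x => v (x - a)].

(** |x> |-> omega^(tr (b . x)) |x>. *)
Definition clock_fun (R : realType) (F : finFieldType) (N : nat) (b : 'rV[F]_N)
    (v : state_space R F N) : state_space R F N :=
  [ffun x => omega R (field_char F) ^+ abs_trace_nat (dotv b x) * v x].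

Definition Xop (R : realType) (F : finFieldType) (N : nat) (a : 'rV[F]_N) :
  'End(state_space R F N) := linfun (@shift_fun R F N a).

Definition Zop (R : realType) (F : finFieldType) (N : nat) (b : 'rV[F]_N) :
  'End(state_space R F N) := linfun (@clock_fun R F N b).

Lemma XopE (R : realType) (F : finFieldType) (N : nat) (a : 'rV[F]_N)
  (v : state_space R F N) : Xop R a v = shift_fun a v.
Proof.
have lin : linear (@shift_fun R F N a).
  by move=> c u w; apply/ffunP => x; rewrite !ffunE.
pose h := GRing.isLinear.Build _ _ _ _ _ lin.
pose f : {linear state_space R F N -> state_space R F N} :=
  HB.pack (@shift_fun R F N a) h.
exact: (lfunE f).
Qed.

Lemma ZopE (R : realType) (F : finFieldType) (N : nat) (b : 'rV[F]_N)
  (v : state_space R F N) : Zop R b v = clock_fun b v.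
Proof.
have lin : linear (@clock_fun R F N b).
  move=> c u w; apply/ffunP => x; rewrite !ffunE.
  by rewrite mulrDr; congr (_ + _); rewrite /GRing.scale /= mulrCA.
pose h := GRing.isLinear.Build _ _ _ _ _ lin.
pose f : {linear state_space R F N -> state_space R F N} :=
  HB.pack (@clock_fun R F N b) h.
exact: (lfunE f).
Qed.

Definition error_op (R : realType) (F : finFieldType) (N : nat) (c : nat)
    (a b : 'rV[F]_N) : 'End(state_space R F N) :=
  phase R (field_char F) ^+ c *: (Xop R a \o Zop R b)%VF.

Definition error_group (R : realType) (F : finFieldType) (N : nat)
    (E : 'End(state_space R F N)) : Prop :=
  exists (c : nat) (a b : 'rV[F]_N), E = error_op R c a b.

Definition error_weight (F : finFieldType) (N : nat) (a b : 'rV[F]_N) : nat :=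
  #|[set i : 'I_N | (a 0 i != 0) || (b 0 i != 0)]|.

Definition abelian_error_subgroup (R : realType) (F : finFieldType) (N : nat)
    (S : 'End(state_space R F N) -> Prop) : Prop :=
  [/\ forall E, S E -> error_group E,
      S \1%VF,
      forall E E', S E -> S E' -> S (E \o E')%VF,
      forall E, S E -> S (E^-1)%VF
    & forall E E', S E -> S E' -> (E \o E')%VF = (E' \o E)%VF].

Definition stabilizer_code (R : realType) (F : finFieldType) (N : nat)
    (C : {vspace state_space R F N}) : Prop :=
  C != 0%VS /\
  exists S : 'End(state_space R F N) -> Prop,
    abelian_error_subgroup S /\
    forall v, v \in C <-> (forall E, S E -> E v = v).

(** Equivalently P E P = lambda P for the orthogonal projector P onto C. *)
Definition detects (R : realType) (F : finFieldType) (N : nat)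
    (C : {vspace state_space R F N}) (E : 'End(state_space R F N)) : Prop :=
  exists lambda : R[i], forall u v, u \in C -> v \in C ->
    hdot u (E v) = lambda * hdot u v.

Definition min_distance (R : realType) (F : finFieldType) (N : nat)
    (C : {vspace state_space R F N}) (d : nat) : Prop :=
  (forall (c : nat) (a b : 'rV[F]_N), (error_weight a b < d)%N ->
     detects C (error_op R c a b)) /\
  (exists (c : nat) (a b : 'rV[F]_N), error_weight a b = d /\
     ~ detects C (error_op R c a b)).

(** Parameters [[N, K, >= d]]_Q with Q = #|F|. *)
Definition stabilizer_code_exists (R : realType) (F : finFieldType)
    (N K d : nat) : Prop :=
  exists C : {vspace state_space R F N},
    [/\ stabilizer_code C, \dim C = (#|F| ^ K)%N
      & exists2 d' : nat, (d <= d')%N & min_distance C d'].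

(* Main.v *)
Require Import Defs.
From HB Require Import structures.
From mathcomp Require Import all_boot all_order all_algebra.
From mathcomp Require Import all_fingroup all_solvable all_field.
From mathcomp Require Import complex reals trigo.
From mathcomp Require boolp.
From mathcomp Require Import zify ring lra.
Import Order.TTheory GRing.Theory Num.Theory.
Set Implicit Arguments.
Unset Strict Implicit.
Unset Printing Implicit Defensive.
Local Open Scope ring_scope.

(** Let Q = q^n and T = P_b. On L = F_(q^2n) the function T takes values in F_q,
    so 1 - T^(q-1) is the indicator of its zero set Z. Expanding it, the sum of
    x^(i + Qj) over Z becomes a combination of sums of x^(e + i + Qj) over L, where
    e is a sum of at most q - 1 exponents of T. Writing e = lo + Q hi with
    lo, hi < Q, such a sum can only be nonzero if i = Q - 1 - lo and
    j = Q - 1 - hi, and A(q, t) is chosen so that min(lo, hi) < Q - 1 - A(q, t),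
    which makes max(i, j) > A(q, t).
    Hence the Reed-Solomon code of degree <= tau on Z is Hermitian self-orthogonal;
    its dual distance is tau + 2 as it is MDS.

    A basis (1, beta) of L over F turns this code into an isotropic subspace D of
    the symplectic space F^N x F^N. The operators X(a)Z(b), (a, b) in D, commute;
    dividing each by its eigenvalue on a common eigenvector gives a group, whose
    averaging projector has trace |F|^N / |D|. An error that is not symplectically
    orthogonal to D has zero matrix coefficients on the code. As 2 tau + 2 < N, the
    code has dimension > 1, so some error is undetected and the minimum distance
    exists. *)

(** * Power sums over a finite field *)

Lemma expf_card_pred (L : finFieldType) (x : L) : x != 0 -> x ^+ #|L|.-1 = 1.
Proof.
move=> x0; apply: (mulfI x0); rewrite mulr1 -exprS prednK ?expf_card //.
by apply/card_gt0P; exists 0.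
Qed.

Lemma natr_card_finField (L : finFieldType) : #|L|%:R = 0 :> L.
Proof.
have [p _ pL] := finPcharP L.
by rewrite (card_pprimeChar pL) natrX (pcharf0 pL) expr0n eqn0Ngt
  -(ltn_exp2l _ _ (prime_gt1 (pcharf_prime pL))) -card_pprimeChar finNzRing_gt1.
Qed.

(** Multiplying the variable by a nonzero [g] multiplies the sum by [g ^+ E], and some [g] has
    [g ^+ E != 1] since ['X^r - 1] has at most [r] roots. For [E = 0] the sum is [#|L|], as
    [0 ^+ 0 = 1]. *)
Lemma sum_expr_finField (L : finFieldType) (E : nat) :
  ~~ ((0 < E)%N && (#|L|.-1 %| E)%N) -> \sum_(x : L) x ^+ E = 0.
Proof.
have L1 := finNzRing_gt1 L.
case: (posnP E) => [-> _|E0 /= ndvd].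
  by under eq_bigr do rewrite expr0; rewrite sumr_const natr_card_finField.
have [g g0 gE] : exists2 g : L, g != 0 & g ^+ E != 1.
  pose r := (E %% #|L|.-1)%N.
  have r0 : (0 < r)%N by rewrite lt0n.
  have rL : (r < #|L|.-1)%N by rewrite ltn_mod -ltnS prednK // ltnW.
  have [/existsP[g /andP[g0 gr]]|/existsPn H] :=
    boolP [exists g : L, (g != 0) && (g ^+ E != 1)]; first by exists g.
  have pn0 : 'X^r - 1 != 0 :> {poly L} by rewrite -size_poly_gt0 size_XnsubC.
  have /(max_poly_roots pn0) : all (root ('X^r - 1)) (enum (predC1 (0 : L))).
    apply/allP => x; rewrite mem_enum => /[!inE] x0; rewrite rootE !hornerE.
    have /[!(x0, negbK)]/= /eqP := H x.
    by rewrite {1}(divn_eq E #|L|.-1) exprD mulnC exprM expf_card_pred // expr1n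
      mul1r => ->; rewrite subrr.
  by rewrite enum_uniq size_XnsubC // -cardE cardC1 ltnS leqNgt rL => /(_ isT).
have : \sum_(x : L) x ^+ E = g ^+ E * \sum_(x : L) x ^+ E.
  rewrite [LHS](reindex_inj (mulfI g0)) mulr_sumr.
  by apply: eq_bigr => x _; rewrite exprMn.
move/eqP; rewrite -{1}[\sum_x _]mul1r -subr_eq0 -mulrBl mulf_eq0 subr_eq0.
by rewrite eq_sym (negPf gE) => /eqP.
Qed.

(** * Exponents of the trace polynomial in base q^n *)

Section ExponentHalves.
Local Open Scope nat_scope.

(** For [k < 2 * n], the two digits of [q ^ k] in base [q ^ n]. *)
Definition low_power (q n k : nat) : nat := if k < n then q ^ k else 0.
Definition high_power (q n k : nat) : nat := if k < n then 0 else q ^ (k - n).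

Lemma low_high_power q n k :
  q ^ k = low_power q n k + q ^ n * high_power q n k.
Proof.
rewrite /low_power /high_power; case: ltnP => [_|nk].
  by rewrite muln0 addn0.
by rewrite add0n -expnD subnKC.
Qed.

(** Halves of [q ^ a + q ^ ((a + t) %% (2 * n))], the exponent of the trace term of index [a] once
    reduced by [x ^+ (q ^ (2 * n)) = x]. *)
Definition low_half (q n t a : nat) : nat :=
  low_power q n a + low_power q n ((a + t) %% (2 * n)).
Definition high_half (q n t a : nat) : nat :=
  high_power q n a + high_power q n ((a + t) %% (2 * n)).

(** The cases tell which of [a] and [(a + t) %% (2 * n)] are below [n]; in the last one [a + t]
    wraps around. *)
Lemma half_cases q n t a : 0 < t <= n -> a < 2 * n ->
  [\/ [/\ a < n - t, low_half q n t a = q ^ a + q ^ (a + t) &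
          high_half q n t a = 0],
      [/\ n - t <= a < n, low_half q n t a = q ^ a &
          high_half q n t a = q ^ (a + t - n)],
      [/\ n <= a < 2 * n - t, low_half q n t a = 0 &
          high_half q n t a = q ^ (a - n) + q ^ (a + t - n)]
    | [/\ 2 * n - t <= a, low_half q n t a = q ^ (a + t - 2 * n) &
          high_half q n t a = q ^ (a - n)] ].
Proof.
move=> /andP[t0 tn] a2n; rewrite /low_half /high_half /low_power /high_power.
have [ltat|geat] := ltnP (a + t) (2 * n).
  rewrite modn_small //; have [a1|a1] := ltnP a (n - t).
    have [-> ->] : (a < n) = true /\ (a + t < n) = true by lia.
    by constructor 1; rewrite addn0.
  have -> : (a + t < n) = false by lia.
  have [a2|a2] := ltnP a n; first by constructor 2; rewrite addn0.
  by constructor 3; split=> //; lia.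
have -> : (a + t) %% (2 * n) = a + t - 2 * n.
  by rewrite -{1}(subnK geat) modnDr modn_small //; lia.
have [-> ->] : (a < n) = false /\ (a + t - 2 * n < n) = true by lia.
by constructor 4; rewrite addn0; split=> //; lia.
Qed.

Lemma sum_size_leq (T : eqType) (f : T -> nat) (M : nat) (l : seq T) :
  {in l, forall a, f a <= M} -> \sum_(a <- l) f a <= size l * M.
Proof.
move=> H; rewrite -sum1_size big_distrl /= big_seq [leqRHS]big_seq.
by apply: leq_sum => a /H; rewrite mul1n.
Qed.

(** When both powers fall in the same half, the other half is 0; otherwise one power is at most
    [q ^ (n - 1)] and the other at most [q ^ (t - 1)]. *)
Lemma half_bounds q n t a : 1 < q -> 0 < t < n -> a < 2 * n ->
  [/\ low_half q n t a <= q ^ (n - 1) + q ^ (n - 1 - t),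
      high_half q n t a <= q ^ (n - 1) + q ^ (n - 1 - t),
      low_half q n t a + high_half q n t a
        <= q ^ (n - 1) + q ^ maxn (n - 1 - t) (t - 1)
    & minn (low_half q n t a) (high_half q n t a) <= q ^ (t - 1)].
Proof.
move=> q1 tn a2n; have q0 : 0 < q by lia.
have E u v : u <= v -> q ^ u <= q ^ v by move=> uv; rewrite leq_pexp2l.
have tn' : 0 < t <= n by lia.
have W1 : q ^ (n - 1 - t) <= q ^ maxn (n - 1 - t) (t - 1) by rewrite E ?leq_maxl.
have W2 : q ^ (t - 1) <= q ^ maxn (n - 1 - t) (t - 1) by rewrite E ?leq_maxr.
have W3 : q ^ (t - 1) <= q ^ (n - 1) by apply: E; lia.
case: (half_cases q tn' a2n) => -[ha -> ->]; rewrite ?minn0 ?min0n ?addn0 ?add0n.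
- have B1 : q ^ a <= q ^ (n - 1 - t) by apply: E; lia.
  have B2 : q ^ (a + t) <= q ^ (n - 1) by apply: E; lia.
  by clear E ha tn tn' a2n; split; lia.
- have B1 : q ^ a <= q ^ (n - 1) by apply: E; lia.
  have B2 : q ^ (a + t - n) <= q ^ (t - 1) by apply: E; lia.
  by clear E ha tn tn' a2n; split; lia.
- have B1 : q ^ (a - n) <= q ^ (n - 1 - t) by apply: E; lia.
  have B2 : q ^ (a + t - n) <= q ^ (n - 1) by apply: E; lia.
  by clear E ha tn tn' a2n; split; lia.
- have B1 : q ^ (a - n) <= q ^ (n - 1) by apply: E; lia.
  have B2 : q ^ (a + t - 2 * n) <= q ^ (t - 1) by apply: E; lia.
  by clear E ha tn tn' a2n; split; lia.
Qed.

Lemma half_diagonal q n a : 0 < q -> 0 < n -> a < n ->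
  low_half q n n a = q ^ a /\ high_half q n n a = q ^ a.
Proof.
move=> q0 n0 an; have nn : 0 < n <= n by lia.
have a2n : a < 2 * n by lia.
by case: (half_cases q nn a2n) => -[ha -> ->]; try lia; rewrite addnK.
Qed.

(* For t < n and q <> 2, [A_bound] comes from [2 * minn lo hi <= lo + hi]; in the
   other cases lo = hi or there is at most one term, and minn lo hi is bounded
   directly. *)
Lemma half_sums q n t tau (l : seq nat) : 1 < q -> 0 < t <= n ->
  all (fun a => a < if t == n then n else 2 * n) l -> size l < q ->
  (tau%:Z <= A_bound q n t)%R ->
  [/\ \sum_(a <- l) low_half q n t a < q ^ n,
      \sum_(a <- l) high_half q n t a < q ^ n
    & minn (\sum_(a <- l) low_half q n t a) (\sum_(a <- l) high_half q n t a)
        + tau + 2 <= q ^ n].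
Proof.
move=> q1 tn /allP al sl; have q0 : 0 < q by lia.
have E u v : u <= v -> q ^ u <= q ^ v by move=> uv; rewrite leq_pexp2l.
have P u : 0 < q ^ u by rewrite expn_gt0 q0.
have eQ : q ^ n = q * q ^ (n - 1) by rewrite -expnS; congr (_ ^ _); lia.
have Q1 := P (n - 1).
rewrite /A_bound => H.
set lo := \sum_(a <- l) low_half _ _ _ _.
set hi := \sum_(a <- l) high_half _ _ _ _.
case: eqVneq al => [tn_eq|tn_neq] al.
  rewrite {t}tn_eq ltnn in tn H lo hi al *.
  have eF : 2 * n <= n = false by lia.
  rewrite {}eF in H.
  have hl : lo <= size l * q ^ (n - 1).
    apply: sum_size_leq => a /al an.
    have [|-> _] := half_diagonal q0 _ an; first lia.
    by apply: E; lia.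
  have hh : hi <= size l * q ^ (n - 1).
    apply: sum_size_leq => a /al an.
    have [|_ ->] := half_diagonal q0 _ an; first lia.
    by apply: E; lia.
  have hs : size l * q ^ (n - 1) <= (q - 1) * q ^ (n - 1).
    by rewrite leq_mul2r; lia.
  have {}H : tau + 2 <= q ^ (n - 1) by move: H; case: (q =P 2) => [->|_]; lia.
  by rewrite eQ; split; nia.
have tn' : 0 < t < n by lia.
have tn1 : t < n by lia.
rewrite tn1 in H.
have hb a : a \in l -> a < 2 * n by exact: al.
have hl : lo <= size l * (q ^ (n - 1) + q ^ (n - 1 - t)).
  by apply: sum_size_leq => a /hb a2; have [] := half_bounds q1 tn' a2.
have hh : hi <= size l * (q ^ (n - 1) + q ^ (n - 1 - t)).
  by apply: sum_size_leq => a /hb a2; have [] := half_bounds q1 tn' a2.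
have hlh : lo + hi <= size l * (q ^ (n - 1) + q ^ maxn (n - 1 - t) (t - 1)).
  rewrite /lo /hi -big_split; apply: sum_size_leq => a /hb a2.
  by have [] := half_bounds q1 tn' a2.
have eM : q * q ^ (n - 1 - t) = q ^ (n - t) by rewrite -expnS; congr (_ ^ _); lia.
have hM : q ^ (n - t) <= q ^ (n - 1) by apply: E; lia.
(* The product with [q - 1] falls short of [q ^ n] by [q ^ (n - 1) - q ^ (n - t) + q ^ (n - 1 - t)],
   which is positive by [hM]. *)
have hs : size l * (q ^ (n - 1) + q ^ (n - 1 - t)) < q ^ n.
  apply: leq_ltn_trans (_ : (q - 1) * (q ^ (n - 1) + q ^ (n - 1 - t)) < _).
    by rewrite leq_mul2r; lia.
  by have := P (n - 1 - t); rewrite mulnBl mulnDr eM eQ; lia.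
split; try lia.
move: H; case: (q =P 2) => [q2|_] H.
  have : minn lo hi <= q ^ (t - 1).
    case: l sl al hb @lo @hi {hl hh hlh hs} => [|a [|b l]] /= sl al hb;
      rewrite ?big_nil ?big_seq1.
    - by rewrite minn0.
    - have /hb a2 : a \in [:: a] by rewrite inE.
      by have [] := half_bounds q1 tn' a2.
    - by move: sl; rewrite q2.
  by move: H; rewrite q2; lia.
set U := q ^ (n - 1) + _ in hlh.
(* [size l <= q - 1 <= 2 * uphalf (q - 1)], hence the ceiling in [A_bound]. *)
have hc : size l * U <= 2 * (uphalf (q - 1) * U).
  rewrite mulnA leq_mul2r; have := uphalf_half (q - 1).
  by have := odd_double_half (q - 1); lia.
suff : (tau%:Z <= (q ^ n)%:Z - (uphalf (q - 1))%:Z * U%:Z - 2)%R by lia.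
(* The maximum is [n - 1 - t] if [2 * t <= n] and [t - 1] otherwise, the exponents in [A_bound]. *)
move: H; rewrite /U; case: ifP => h.
  by have -> : maxn (n - 1 - t) (t - 1) = n - t - 1; lia.
by have -> : maxn (n - 1 - t) (t - 1) = t - 1; lia.
Qed.

End ExponentHalves.

(** * Orthogonality on the zero set of the trace polynomial *)

Lemma prime_power_gt1 q : prime_power q -> (1 < q)%N.
Proof.
by case=> p [k [pp k0 ->]]; rewrite -(exp1n k) ltn_exp2r // prime_gt1.
Qed.

Lemma exprD_prime_power (L : finFieldType) (q m r : nat) (x y : L) :
  prime_power q -> (0 < m)%N -> #|L| = (q ^ m)%N ->
  (x + y) ^+ (q ^ r) = x ^+ (q ^ r) + y ^+ (q ^ r).
Proof.
case=> p [k [pp k0 ->]] m0 hL; rewrite -expnM in hL *.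
have pL := card_finPcharP hL pp.
by rewrite exprDn_pchar // (eq_pnat _ (pcharf_eq pL)) !pnatX pnat_id.
Qed.

Section TraceLocus.
Variables (L : finFieldType) (q n t : nat).
Hypotheses (hq : prime_power q) (hn : (0 < n)%N) (ht0 : (0 < t)%N)
  (htn : (t <= n)%N) (hL : #|L| = (q ^ (2 * n))%N).

Let J := if t == n then n else (2 * n)%N.

Lemma horner_P_poly (x : L) :
  (P_poly L q n t).[x] = 1 + \sum_(a < J) (x ^+ (1 + q ^ t)) ^+ (q ^ a).
Proof.
by rewrite /P_poly /tr_poly !hornerE horner_sum; congr (_ + _);
  apply: eq_bigr => i _; rewrite !hornerE.
Qed.

Lemma expr_q2n (x : L) : x ^+ (q ^ (2 * n)) = x.
Proof. by rewrite -hL expf_card. Qed.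

Lemma trace_term (x : L) (a : nat) : (a < J)%N ->
  (x ^+ (1 + q ^ t)) ^+ (q ^ a)
  = x ^+ (low_half q n t a + q ^ n * high_half q n t a).
Proof.
move=> aJ; have a2 : (a < 2 * n)%N by move: aJ; rewrite /J; case: ifP; lia.
have -> : (low_half q n t a + q ^ n * high_half q n t a
           = q ^ a + q ^ ((a + t) %% (2 * n)))%N.
  rewrite /low_half /high_half (low_high_power q n a).
  by rewrite (low_high_power q n ((a + t) %% (2 * n))); lia.
rewrite exprAC exprD exprD expr1 -exprM -expnD; congr (_ * _).
have [ltat|geat] := ltnP (a + t) (2 * n); first by rewrite modn_small.
have e : ((a + t) %% (2 * n) = a + t - 2 * n)%N.
  by rewrite -{1}(subnK geat) modnDr modn_small //; lia.
by rewrite e -[in LHS](subnK geat) addnC expnD exprM expr_q2n.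
Qed.

(** The power [q] shifts the terms of the trace cyclically. *)
Lemma horner_P_poly_Frobenius (x : L) :
  (P_poly L q n t).[x] ^+ q = (P_poly L q n t).[x].
Proof.
have q0 : (0 < q)%N by apply: ltnW (prime_power_gt1 hq).
have frobD (y z : L) : (y + z) ^+ q = y ^+ q + z ^+ q.
  by rewrite -[q]expn1 (@exprD_prime_power _ _ (2 * n)) // muln_gt0.
have frob0 : (0 : L) ^+ q = 0 by rewrite expr0n eqn0Ngt q0.
(* For [t = n] this is the norm of [x] to the field of [q ^ n] elements, so [n] terms already close
   the cycle. *)
have yJ : (x ^+ (1 + q ^ t)) ^+ (q ^ J) = x ^+ (1 + q ^ t).
  rewrite /J; case: eqP => [->|_]; last by rewrite expr_q2n.
  by rewrite exprAC exprD exprD expr1 -exprM -expnD addnn -mul2n expr_q2n mulrC.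
rewrite horner_P_poly frobD expr1n (big_morph _ frobD frob0); congr (_ + _).
move: yJ; move: (x ^+ (1 + q ^ t)) => y yJ.
under eq_bigr do rewrite -exprM -expnSr.
have J0 : (0 < J)%N by rewrite /J; case: ifP; rewrite ?muln_gt0 ?hn.
move: yJ; rewrite -(prednK J0) => yJ.
rewrite big_ord_recr [RHS]big_ord_recl /= yJ addrC expr1; congr (_ + _).
Qed.

(** [x ^+ (i + q ^ n * j)] is the product of [x ^+ i] and the conjugate of [x ^+ j], so this is
    Hermitian orthogonality of monomials on the locus. *)
Lemma trace_locus_orthogonal (tau i j : nat) :
  tau%:Z <= A_bound q n t -> (i <= tau)%N -> (j <= tau)%N ->
  \sum_(x : L | root (P_poly L q n t) x) x ^+ (i + q ^ n * j) = 0.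
Proof.
move=> htau hi hj; have q1 := prime_power_gt1 hq.
pose T (x : L) := (P_poly L q n t).[x].
pose e a := (low_half q n t a + q ^ n * high_half q n t a)%N.
(* [l] lists the terms of [T] chosen so far, in the factors already expanded. *)
have key s l : all (fun a => (a < J)%N) l -> (size l + s < q)%N ->
    \sum_(x : L) T x ^+ s * x ^+ (\sum_(a <- l) e a + (i + q ^ n * j)) = 0.
  elim: s l => [|s IHs] l al sl; last first.
    (* One factor [T x] is expanded: its constant 1 keeps [l], and its term of index [b] is recorded
       in front of [l]. *)
    have -> : \sum_x T x ^+ s.+1 * x ^+ (\sum_(a <- l) e a + (i + q ^ n * j))
      = \sum_x T x ^+ s * x ^+ (\sum_(a <- l) e a + (i + q ^ n * j))
      + \sum_(b < J) \sum_x T x ^+ s * x ^+ 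
          (\sum_(a <- (b : nat) :: l) e a + (i + q ^ n * j)).
      rewrite exchange_big -big_split; apply: eq_bigr => x _ /=.
      rewrite exprSr -mulrA {2}/T horner_P_poly mulrDl mul1r.
      rewrite mulrDr big_distrl big_distrr; congr (_ + _).
      apply: eq_bigr => b _ /=.
      by rewrite big_cons trace_term // -exprD addnA.
    rewrite (IHs l al) ?add0r; last lia.
    apply: big1 => b _; apply: IHs; rewrite /= ?ltn_ord //; lia.
  rewrite (eq_bigr _ (fun x _ => mul1r _)).
  apply: sum_expr_finField; rewrite hL.
  rewrite addn0 in sl.
  have tn : (0 < t <= n)%N by rewrite ht0.
  have -> : (\sum_(a <- l) e a = \sum_(a <- l) low_half q n t a
      + q ^ n * \sum_(a <- l) high_half q n t a)%N.
    by rewrite big_distrr -big_split.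
  have [] := half_sums q1 tn al sl htau.
  have -> : (q ^ (2 * n) = q ^ n * q ^ n)%N by rewrite mul2n -addnn expnD.
  set lo := (\sum_(a <- l) low_half _ _ _ _)%N.
  set hi' := (\sum_(a <- l) high_half _ _ _ _)%N; set Q := (q ^ n)%N.
  move=> lo1 hi1 h.
  have -> : (lo + Q * hi' + (i + Q * j) = (lo + i) + Q * (hi' + j))%N by lia.
  apply/negP => /andP[E0 /dvdnP[c ec]].
  have X1 : (lo + i + 3 <= 2 * Q)%N by lia.
  have Y1 : (hi' + j + 2 <= 2 * Q)%N by lia.
  have Q0 : (0 < Q)%N by rewrite expn_gt0 ltnW.
  (* The exponent is [c * (Q * Q - 1)]. [E0] excludes [c = 0] and the bounds [X1], [Y1] exclude
     [c >= 2]; for [c = 1] both parts must be [Q - 1]. *)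
  have [X Y] : (lo + i = Q - 1)%N /\ (hi' + j = Q - 1)%N.
    move: (lo + i)%N (hi' + j)%N X1 Y1 E0 ec => X Y X1 Y1 E0 ec.
    case: c ec => [|[|c]] ec; first by rewrite ec in E0.
      2: have : (2 * (Q * Q).-1 <= c.+2 * (Q * Q).-1)%N by rewrite leq_mul2r; lia.
      2: by nia.
    have {}ec : (X + Q * Y + 1 = Q * Q)%N by nia.
    have Y2 : (Y < Q)%N by rewrite -(ltn_pmul2l Q0); lia.
    have [Y3|Y3] := leqP (Q - 1) Y; last first.
      have H : (Q * Y <= Q * (Q - 2))%N by rewrite leq_pmul2l; lia.
      have H2 : (2 * Q <= Q * Q)%N by rewrite leq_mul2r; lia.
      by move: H; rewrite mulnBr; lia.
    have {Y2 Y3} eY : (Y = Q - 1)%N by lia.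
    by move: ec; rewrite eY; nia.
  (* Now [lo] and [hi'] are both at least [Q - 1 - tau], against [h]. *)
  by clearbody lo hi'; lia.
have q2 : q.-1 == 0%N = false by lia.
have -> : \sum_(x : L | root (P_poly L q n t) x) x ^+ (i + q ^ n * j)
   = \sum_x (x ^+ (i + q ^ n * j) - T x ^+ q.-1 * x ^+ (i + q ^ n * j)).
  rewrite big_mkcond; apply: eq_bigr => x _; rewrite rootE -/(T x).
  case: eqVneq => [->|Tx0]; first by rewrite expr0n q2 mul0r subr0.
  have : T x ^+ q.-1 = 1.
    apply: (mulfI Tx0); rewrite -exprS mulr1 prednK ?(ltnW q1) //.
    exact: horner_P_poly_Frobenius.
  by move=> ->; rewrite mul1r subrr.
rewrite sumrB.
have := key 0%N [::] isT; rewrite big_nil add0n /= => /(_ (ltnW q1)).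
rewrite (eq_bigr _ (fun x _ => mul1r _)).
move=> ->; rewrite sub0r.
have := key q.-1 [::] isT; rewrite big_nil add0n => ->; first by rewrite oppr0.
by rewrite /=; lia.
Qed.

End TraceLocus.

(** * Size of the zero set *)

Lemma A_bound_leq q n t tau : (1 < q)%N -> (0 < t <= n)%N ->
  tau%:Z <= A_bound q n t -> (tau + 2 <= q ^ n)%N.
Proof.
move=> q1 tn htau; have := @half_sums q n t tau [::] q1 tn isT (ltnW q1) htau.
by rewrite !big_nil => -[].
Qed.

(** For [n = 1] also [t = 1], and [A_bound] is -1. *)
Lemma A_bound_n_gt1 q n t tau : (1 < q)%N -> (0 < t <= n)%N ->
  tau%:Z <= A_bound q n t -> (1 < n)%N.
Proof.
move=> q1 tn; case: ltnP => // n1; have [-> ->] : n = 1%N /\ t = 1%N by lia.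
by rewrite /A_bound /=; case: (q =P 2%N) => [_|_]; rewrite ?subnn ?expn0; lia.
Qed.

(** This makes the dimension exponent of the code positive; it holds as [2 * tau + 2 < 2 * q ^ n <=
    q ^ n.+1 <= q ^ (2 * n - 1)]. *)
Lemma locus_size_gt q n t tau : (1 < q)%N -> (0 < t <= n)%N ->
  tau%:Z <= A_bound q n t ->
  (2 * tau + 2 < q ^ (2 * n - 1 - t) + q ^ (2 * n - 1))%N.
Proof.
move=> q1 tn htau; have n1 := A_bound_n_gt1 q1 tn htau.
have := A_bound_leq q1 tn htau => le.
have h : (q ^ n.+1 <= q ^ (2 * n - 1))%N by rewrite leq_pexp2l; lia.
have h2 : (2 * q ^ n <= q ^ n.+1)%N by rewrite expnS leq_mul2r q1 orbT.
lia.
Qed.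

Section TraceLocusCard.
Variables (L : finFieldType) (q n t tau : nat).
Hypotheses (hq : prime_power q) (hn : (0 < n)%N) (ht0 : (0 < t)%N)
  (htn : (t <= n)%N) (hL : #|L| = (q ^ (2 * n))%N)
  (htau : tau%:Z <= A_bound q n t).

Lemma root_P_poly0 : ~~ root (P_poly L q n t) 0.
Proof.
have q0 : (0 < q)%N by apply: ltnW (prime_power_gt1 hq).
rewrite rootE horner_P_poly big1 ?addr0 ?oner_eq0 // => a _.
by rewrite add1n expr0n /= expr0n expn_eq0 eqn0Ngt q0.
Qed.

Lemma root_Tr_poly (x : L) :
  x != 0 -> root (Tr_poly L q n t) x = root (P_poly L q n t) x.
Proof.
move=> x0; rewrite /Tr_poly !rootE.
rewrite [in RHS](divp_eq (P_poly L q n t) ('X^(q ^ (2 * n) - 1) - 1)).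
rewrite !hornerE -hL.
by rewrite subn1 expf_card_pred // subrr mulr0 add0r.
Qed.

(* The reduction modulo [X^(q^(2n) - 1) - 1] may only change the value at 0,
   and then the numbers of roots differ by one; both are multiples of the
   characteristic, the one of [P_b] because the constant 1 is orthogonal to
   itself on the locus. *)
Lemma card_trace_locus :
  #|[set x : L | root (Tr_poly L q n t) x]|
    = (q ^ (2 * n - 1 - t) + q ^ (2 * n - 1))%N ->
  #|[set x : L | root (P_poly L q n t) x]|
    = (q ^ (2 * n - 1 - t) + q ^ (2 * n - 1))%N.
Proof.
have q1 := prime_power_gt1 hq.
have tn : (0 < t <= n)%N by rewrite ht0.
have n1 := A_bound_n_gt1 q1 tn htau.
have card0 : #|[set x : L | root (P_poly L q n t) x]|%:R = 0 :> L.
  rewrite -(trace_locus_orthogonal hq hn ht0 htn hL htau (leq0n _) (leq0n _)).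
  under eq_bigr do rewrite muln0 expr0.
  by rewrite sumr_const; congr _%:R; apply: eq_card => x; rewrite !inE.
have q0 : q%:R = 0 :> L.
  have /eqP := natr_card_finField L.
  by rewrite hL natrX expf_eq0 => /andP[_ /eqP].
rewrite (cardsD1 0) inE.
have -> : [set x : L | root (Tr_poly L q n t) x] :\ 0
    = [set x : L | root (P_poly L q n t) x].
  apply/setP => x; rewrite !inE; case: eqVneq => [->|/root_Tr_poly //].
  by rewrite (negPf root_P_poly0).
case: (root _ 0) => // /(congr1 (fun k : nat => k%:R : L)) /eqP.
(* By [1 < n] both exponents are positive, so the assumed number of roots is 0 in [L]; an additional
   root at 0 would give [1 = 0]. *)
have e1 : (0 < 2 * n - 1 - t)%N by lia.
have e2 : (0 < 2 * n - 1)%N by lia.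
by rewrite !natrD card0 !natrX q0 !expr0n !eqn0Ngt e1 e2 !addr0 oner_eq0.
Qed.

End TraceLocusCard.

(** * Embeddings of finite fields *)

Lemma finField_generator (F : finFieldType) :
  exists a : F, forall x, x != 0 -> exists i, x = a ^+ i.
Proof.
have /cyclicP[u Gu] := field_unit_group_cyclic [set: {unit F}]%G.
exists (val u) => x x0.
have ux : x \is a GRing.unit by rewrite unitfE.
have /cycleP[i /(congr1 val) /= e] : FinRing.unit F ux \in <[u]>%g.
  by rewrite -Gu inE.
by exists i; rewrite e FinRing.val_unitX.
Qed.

(** [F] is generated over [F_p] by a primitive element [a], whose minimal polynomial [mu] divides
    [X^|L| - X] because [a ^+ #|L| = a]. So [mu] has a root [b] in [L], and [r(a)] is sent to
    [r(b)]. *)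
Lemma finField_embedding (F L : finFieldType) (m : nat) :
  (0 < m)%N -> #|L| = (#|F| ^ m)%N -> exists iota : {rmorphism F -> L}, True.
Proof.
move=> m0 hL; have [p pp pF] := finPcharP F.
have pL : p \in [pchar L].
  apply: (@card_finPcharP _ _ (logn p #|F| * m)) => //.
  by rewrite hL {1}(card_pprimeChar pF) -expnM.
pose F' := pPrimeCharType pF; pose L' := pPrimeCharType pL.
have [a gen_a] := finField_generator F.
pose evF := horner_alg (a : F').
have evFE (r : {poly 'F_p}) : evF r = (map_poly (in_alg F') r).[a] by [].
have surjF (x : F') : exists r, evF r == x.
  case: (eqVneq x 0) => [->|/gen_a[i ->]].
    by exists 0; rewrite /evF rmorph0.
  by exists 'X^i; rewrite /evF rmorphXn /= horner_algX.
have [mu mu_nc mu_min] : exists2 mu : {poly 'F_p}, (1 < size mu)%N &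
    forall r, evF r = 0 -> mu %| r.
  have /polyOver1P[mu emu] := minPolyOver (1%AS : {subfield F'}) (a : F').
  exists mu.
    have := size_minPoly (1%AS : {subfield F'}) (a : F').
    by rewrite emu size_map_poly => ->.
  move=> r er; rewrite -(dvdp_map (in_alg F')) -emu.
  by apply: minPoly_dvdp; [apply/polyOver1P; exists r | apply/eqP].
have [b rb] : exists b : L', root (map_poly (in_alg L') mu) b.
  have aL : a ^+ #|L| = a.
    rewrite hL; elim: (m) => [|k IH]; first by rewrite expr1.
    by rewrite expnSr exprM IH expf_card.
  have : mu %| 'X^#|L| - 'X.
    apply: mu_min; rewrite /evF rmorphB rmorphXn /= horner_algX.
    by rewrite [X in X - _]aL subrr.
  rewrite -(dvdp_map (in_alg L')) rmorphB rmorphXn /= map_polyX.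
  rewrite [X in _ %| X](finField_genPoly L).
  case/dvdp_prod_XsubC => s; case: (mask _ _) => [|b r].
    rewrite big_nil => /eqp_size; rewrite size_map_poly size_poly1.
    by case: size mu_nc => [|[]].
  rewrite big_cons => e; exists b.
  by rewrite (eqp_root e) rootM root_XsubC eqxx.
pose evL := horner_alg (b : L').
have kerL r : evF r = 0 -> evL r = 0.
  move=> /mu_min /divpK <-; rewrite /evL rmorphM /=.
  by have /eqP -> : horner_alg (b : L') mu == 0 := rb; rewrite mulr0.
have eqL r s : evF r = evF s -> evL r = evL s.
  move=> e; apply/eqP; rewrite -subr_eq0; apply/eqP.
  transitivity (evL (r - s)); first by rewrite [RHS]rmorphB.
  by apply: kerL; rewrite [LHS]rmorphB; apply/eqP; rewrite subr_eq0; apply/eqP.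
(* The polynomial representing [x] is an arbitrary choice; by [eqL] the image does not depend on
   it. *)
pose iota (x : F) : L := evL (xchoose (surjF x)).
have iotaE r : iota (evF r) = evL r.
  by apply: eqL; apply/eqP; exact: (xchooseP (surjF (evF r))).
have addI : zmod_morphism iota.
  move=> x y.
  have /eqP <- := xchooseP (surjF x); have /eqP <- := xchooseP (surjF y).
  by rewrite -[X in iota X = _]rmorphB !iotaE [LHS]rmorphB.
have mulI : monoid_morphism iota.
  split.
    rewrite -[X in iota X = _](rmorph1 (horner_alg (a : F'))) iotaE.
    by rewrite [LHS]rmorph1.
  move=> x y.
  have /eqP <- := xchooseP (surjF x); have /eqP <- := xchooseP (surjF y).
  by rewrite -[X in iota X = _]rmorphM !iotaE [LHS]rmorphM.
pose h1 := GRing.isZmodMorphism.Build _ _ _ addI.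
pose h2 := GRing.isMonoidMorphism.Build _ _ _ mulI.
pose iotaM : {rmorphism F -> L} := HB.pack iota h1 h2.
by exists iotaM.
Qed.

(** * Hermitian codes as isotropic spaces *)

Section QuadraticExtension.
Variables (F L : finFieldType) (iota : {rmorphism F -> L}).
Hypothesis cardL : #|L| = (#|F| ^ 2)%N.
Let Q := #|F|.

Lemma expr_iota c : iota c ^+ Q = iota c.
Proof. by rewrite -rmorphXn /= expf_card. Qed.

Lemma exprD_card (x y : L) : (x + y) ^+ Q = x ^+ Q + y ^+ Q.
Proof.
have [p pp pF] := finPcharP F.
rewrite -[Q]expn1 (@exprD_prime_power _ _ 2) //.
exists p, (logn p #|F|); split=> //; last exact: card_pprimeChar pF.
by rewrite -(ltn_exp2l _ _ (prime_gt1 pp)) -card_pprimeChar finNzRing_gt1.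
Qed.

(** ['X^Q - 'X] has at most [Q < Q ^ 2] roots. Such a [beta] lies outside the image of [F], so [1]
    and [beta] form a basis of [L]. *)
Lemma exists_not_fixed : exists beta : L, beta ^+ Q != beta.
Proof.
apply/existsP; apply: contraT => /existsPn H.
have Q1 : (1 < Q)%N by exact: finNzRing_gt1.
have p0 : 'X^Q - 'X != 0 :> {poly L}.
  by rewrite -size_poly_gt0 size_polyDl ?size_polyXn // size_polyN size_polyX.
have /(max_poly_roots p0) : all (root ('X^Q - 'X)) (enum L).
  by apply/allP => x _; rewrite rootE !hornerE subr_eq0 -[_ == _]negbK H.
rewrite enum_uniq -cardE cardL size_polyDl size_polyXn;
  last by rewrite size_polyN size_polyX.
by move=> /(_ isT); rewrite ltnS leqNgt /Q -[X in (X < _)%N]expn1 ltn_exp2l.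
Qed.

Variable beta : L.
Hypothesis betaQ : beta ^+ Q != beta.

Definition coord_comb (ab : F * F) : L := iota ab.1 + iota ab.2 * beta.

Lemma coord_comb_inj : injective coord_comb.
Proof.
move=> [a b] [a' b'] /eqP; rewrite /coord_comb /= -subr_eq0 => e.
have {}e : iota (b - b') * beta = iota (a' - a).
  by apply/eqP; rewrite -subr_eq0 -(eqP e) !rmorphB; apply/eqP; ring.
have [/eqP|b0] := eqVneq (b - b') 0.
  move: e => /[swap]; rewrite subr_eq0 => /eqP ->.
  rewrite subrr rmorph0 mul0r => /esym/eqP.
  by rewrite fmorph_eq0 subr_eq0 => /eqP ->.
case/negP: betaQ; have -> : beta = iota ((a' - a) / (b - b')).
  by rewrite fmorph_div -e mulrAC divff ?fmorph_eq0 ?mul1r.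
by rewrite expr_iota.
Qed.

Lemma coord_comb_bij : bijective coord_comb.
Proof.
by apply: inj_card_bij; [exact: coord_comb_inj | rewrite card_prod cardL mulnn].
Qed.

Lemma coord_combD u v : coord_comb (u + v) = coord_comb u + coord_comb v.
Proof. by rewrite /coord_comb !rmorphD /=; ring. Qed.

Lemma coord_combZ c u : coord_comb (c * u.1, c * u.2) = iota c * coord_comb u.
Proof. by rewrite /coord_comb !rmorphM /=; ring. Qed.

(** The Hermitian product [x * y ^+ Q] minus its conjugate. *)
Definition skew_form (x y : L) : L := x * y ^+ Q - x ^+ Q * y.

(* The coordinates turn the skew Hermitian form of L over F into the symplectic
   form of F^2, up to the nonzero factor beta^Q - beta. *)
Lemma skew_form_coord u v :
  skew_form (coord_comb u) (coord_comb v)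
  = iota (u.1 * v.2 - u.2 * v.1) * (beta ^+ Q - beta).
Proof.
rewrite /skew_form /coord_comb !exprD_card !exprMn !expr_iota rmorphB !rmorphM.
by ring.
Qed.

End QuadraticExtension.

(** * Reed-Solomon codes and the isotropic spaces they define *)

Section EvaluationCode.
Variables (L : finFieldType) (N k : nat) (z : 'I_N -> L).

Definition codeword (f : 'rV[L]_k) (i : 'I_N) : L :=
  \sum_(j < k) f 0 j * z i ^+ j.

Lemma codewordD f g i : codeword (f + g) i = codeword f i + codeword g i.
Proof.
by rewrite /codeword -big_split; apply: eq_bigr => j _; rewrite mxE mulrDl.
Qed.

Lemma codewordZ c f i : codeword (c *: f) i = c * codeword f i.
Proof.
by rewrite /codeword mulr_sumr; apply: eq_bigr => j _; rewrite mxE mulrA.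
Qed.

Lemma codeword_poly (p : {poly L}) i : (size p <= k)%N ->
  codeword (\row_j p`_j) i = p.[z i].
Proof.
move=> sp; rewrite (horner_coef_wide _ sp).
by apply: eq_bigr => j _; rewrite mxE.
Qed.

Hypothesis z_inj : injective z.

(** Lagrange interpolation in degree [#|S| - 1]. It gives the dual distance: a nonzero vector
    supported in at most [k] places is not orthogonal to the code. *)
Lemma codeword_interpolation (S : {set 'I_N}) i0 : i0 \in S -> (#|S| <= k)%N ->
  exists f, codeword f i0 = 1 /\ {in S, forall i, i != i0 -> codeword f i = 0}.
Proof.
move=> i0S Sk; pose r := \prod_(j in S :\ i0) ('X - (z j)%:P).
have sr : size r = #|S|.
  by rewrite /r -big_enum size_prod_XsubC -cardE (cardsD1 i0 S) i0S.
have r0 : r.[z i0] != 0.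
  rewrite /r horner_prod; apply/prodf_neq0 => j.
  rewrite !inE !hornerE => /andP[ji _].
  by rewrite subr_eq0; apply: contra ji => /eqP/z_inj ->.
have sc : (size (r.[z i0]^-1 *: r) <= k)%N.
  by rewrite (leq_trans (size_scale_leq _ _)) ?sr.
exists (\row_j (r.[z i0]^-1 *: r)`_j); split.
  by rewrite codeword_poly // hornerZ mulVf.
move=> i iS ii0; rewrite codeword_poly //.
have ri : r.[z i] = 0.
  rewrite /r horner_prod (bigD1 i) /=; last by rewrite !inE ii0.
  by rewrite hornerXsubC subrr mul0r.
by rewrite hornerZ ri mulr0.
Qed.

Lemma codeword_inj f : (k <= N)%N -> (forall i, codeword f i = 0) -> f = 0.
Proof.
move=> kN f0; pose p := rVpoly f.
have cp i : p.[z i] = 0.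
  rewrite -(codeword_poly i (size_poly _ _)) -[RHS](f0 i).
  by congr codeword; exact: rVpolyK.
suff p0 : p = 0 by rewrite -[f]rVpolyK -/p p0 linear0.
apply: contraTeq kN => p0; rewrite -ltnNge -[N]card_ord.
have := @max_poly_roots _ _ (map z (enum 'I_N)) p0.
rewrite size_map -cardE map_inj_uniq ?enum_uniq // => H.
apply: leq_trans (H _ isT) (size_poly _ _).
by apply/allP => _ /mapP[i _ ->]; rewrite rootE cp.
Qed.

End EvaluationCode.

(** [A g] and [B g] are the coordinates of the codeword of [g] in the basis [(1, beta)]. In the last
    clause all values [s] are reached, so that one of nonzero absolute trace can be chosen. *)
Lemma hermitian_isotropic_family (F L : finFieldType) (N k : nat)
    (z : 'I_N -> L) :
    #|L| = (#|F| ^ 2)%N -> injective z -> (k <= N)%N ->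
    (forall i j, (i < k)%N -> (j < k)%N -> \sum_l z l ^+ (i + #|F| * j) = 0) ->
  exists A B : 'rV[L]_k -> 'rV[F]_N,
  [/\ {morph A : g h / g + h}, {morph B : g h / g + h},
      forall g, A g = 0 -> B g = 0 -> g = 0,
      forall g h, dotv (B g) (A h) = dotv (B h) (A g)
    & forall a b, (0 < error_weight a b <= k)%N ->
        forall s, exists g, dotv (B g) a - dotv b (A g) = s].
Proof.
move=> hL z_inj kN orth.
have [iota _] := finField_embedding (ltn0Sn 1) hL.
have [beta betaQ] := exists_not_fixed hL.
pose cc := coord_comb iota beta.
have cc_inj : injective cc by apply: coord_comb_inj.
have [pr prK ccK] : bijective cc := coord_comb_bij iota hL betaQ.
have prD x y : pr (x + y) = pr x + pr y.
  by apply: cc_inj; rewrite [in RHS]/cc coord_combD -/cc !ccK.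
have prZ c x : pr (iota c * x) = (c * (pr x).1, c * (pr x).2).
  by apply: cc_inj; rewrite [in RHS]/cc coord_combZ -/cc !ccK.
have pr0 : pr 0 = 0 by apply: (addIr (pr 0)); rewrite -prD !add0r.
pose cw := @codeword L N k z.
pose A g := \row_i (pr (cw g i)).1; pose B g := \row_i (pr (cw g i)).2.
set d0 := beta ^+ #|F| - beta.
have d0_neq0 : d0 != 0 by rewrite subr_eq0.
have skewE a b g : iota (dotv (B g) a - dotv b (A g)) * d0
    = \sum_i @skew_form F L (cc (a 0 i, b 0 i)) (cw g i).
  rewrite -sumrB rmorph_sum mulr_suml; apply: eq_bigr => i _.
  rewrite -[cw g i in RHS]ccK skew_form_coord // /d0 /= !mxE !rmorphB !rmorphM.
  by ring.
have Q0 : #|F| == 0%N = false by rewrite eqn0Ngt ltnW // finNzRing_gt1.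
have orthC g h : \sum_i cw g i * cw h i ^+ #|F| = 0.
  have cwQ i : cw h i ^+ #|F| = \sum_(l < k) h 0 l ^+ #|F| * z i ^+ (#|F| * l).
    have Z0 : 0 ^+ #|F| = 0 :> L by rewrite expr0n Q0.
    rewrite /cw /codeword (big_morph _ (exprD_card hL) Z0).
    by apply: eq_bigr => l _; rewrite exprMn -exprM mulnC.
  under eq_bigr do rewrite cwQ /cw /codeword big_distrlr /=.
  rewrite exchange_big big1 // => j _; rewrite exchange_big big1 // => l _ /=.
  under eq_bigr do rewrite mulrACA -exprD.
  by rewrite -mulr_sumr orth // mulr0.
exists A, B; split.
- by move=> g h; apply/rowP => i; rewrite !mxE [cw _ _]codewordD prD.
- by move=> g h; apply/rowP => i; rewrite !mxE [cw _ _]codewordD prD.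
- move=> g Ag Bg; apply: (codeword_inj z_inj kN) => i.
  rewrite -[codeword _ _ _]ccK -[RHS](ccK 0) pr0; congr cc.
  move/rowP/(_ i): Ag; move/rowP/(_ i): Bg; rewrite !mxE.
  by rewrite /cw; case: (pr _) => u v /= -> ->.
- move=> g h; apply/eqP; rewrite -subr_eq0 -(fmorph_eq0 iota).
  rewrite -[_ == 0]orbF -(negPf d0_neq0) -mulf_eq0 skewE.
  rewrite (eq_bigr (fun i => cw h i * cw g i ^+ #|F|
                             - cw g i * cw h i ^+ #|F|)).
    by rewrite sumrB !orthC subrr.
  move=> i _; rewrite !mxE -surjective_pairing -/cc ccK.
  by rewrite /skew_form [_ ^+ _ * _]mulrC.
move=> a b /andP[w0 wk] s.
pose x i := cc (a 0 i, b 0 i).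
have suppE i : ((a 0 i != 0) || (b 0 i != 0)) = (x i != 0).
  rewrite -negb_and; congr (~~ _); apply/andP/eqP => [[/eqP a0 /eqP b0]|].
    by rewrite /x a0 b0 -[RHS](ccK 0) pr0.
  by move=> /(congr1 pr); rewrite prK pr0 => -[-> ->].
pose S := [set i | x i != 0].
have SE : error_weight a b = #|S| by apply: eq_card => i; rewrite !inE suppE.
rewrite SE in w0 wk; have [i0 i0S] := card_gt0P w0.
have [f [f1 f0]] := codeword_interpolation z_inj i0S wk.
(* Within the support of the error, [f] is nonzero only at [i0], so a single term remains. *)
have skewf y : iota (dotv (B (y *: f)) a - dotv b (A (y *: f))) * d0
    = @skew_form F L (x i0) y.
  rewrite skewE (bigD1 i0) //= /cw codewordZ f1 mulr1 big1 ?addr0 // => i ii0.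
  rewrite codewordZ; have [xi|xi] := boolP (i \in S).
    by rewrite f0 // mulr0 /skew_form expr0n Q0 !mulr0 subrr.
  move: xi; rewrite inE negbK => /eqP xi.
  by rewrite -/(x i) xi /skew_form expr0n Q0 !mul0r subrr.
(* Otherwise [y = 1] gives [x i0 = x i0 ^+ #|F|], and then [y = beta] gives [x i0 * d0 = 0]. *)
have [g g0] : exists g, dotv (B g) a - dotv b (A g) != 0.
  apply/existsP; apply: contraT => /existsPn H.
  have sk0 y : @skew_form F L (x i0) y = 0.
    have /negbNE/eqP e := H (y *: f).
    by rewrite -skewf e rmorph0 mul0r.
  have x0Q : x i0 = x i0 ^+ #|F|.
    by apply/eqP; rewrite -subr_eq0 -(sk0 1) /skew_form expr1n !mulr1.
  have := sk0 beta; rewrite /skew_form -x0Q -mulrBr => /eqP.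
  by rewrite mulf_eq0 (negPf d0_neq0) orbF; move: i0S; rewrite inE => /negPf ->.
exists (iota (s / (dotv (B g) a - dotv b (A g))) *: g).
set c := s / _.
have dotZ : dotv (B (iota c *: g)) a - dotv b (A (iota c *: g))
    = c * (dotv (B g) a - dotv b (A g)).
  rewrite mulrBr !mulr_sumr; congr (_ - _); apply: eq_bigr => i _;
    by rewrite !mxE [cw (_ *: _) _]codewordZ prZ /=; ring.
by rewrite dotZ divfK.
Qed.

(** * Characters *)

Section RootsOfUnity.
Variables (R : realType) (p : nat).
Hypothesis pp : prime p.

Lemma omega_expr k :
  omega R p ^+ k
  = Complex (cos (k%:R * (2 * pi / p%:R))) (sin (k%:R * (2 * pi / p%:R))).
Proof.
rewrite /omega; move: (2 * pi / p%:R) => theta.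
elim: k => [|k IH]; first by rewrite expr0 mul0r cos0 sin0.
rewrite exprS IH -[k.+1%:R]natr1 mulrDl mul1r cosD sinD.
by apply/eqP; rewrite eq_complex /=; apply/andP; split; apply/eqP; ring.
Qed.

(** The order divides [p], and it is not 1: the cosine is -1 for [p = 2], and the sine is positive
    for [p > 2]. *)
Lemma omega_prim : p.-primitive_root (omega R p).
Proof.
have p0 : p%:R != 0 :> R by rewrite pnatr_eq0 -lt0n prime_gt0.
have wp : omega R p ^+ p = 1.
  rewrite omega_expr mulrCA divff // mulr1 (natrD _ 1 1) mulrDl mul1r.
  rewrite (cosD pi pi) (sinD pi pi) cospi sinpi; apply/eqP.
  by rewrite eq_complex /=; apply/andP; split; apply/eqP; ring.
have [m mp mp'] := prim_order_exists (prime_gt0 pp) wp.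
have [_ /(_ m mp') /orP[/eqP m1|/eqP mE]] := primeP pp;
  last by rewrite mE in mp.
move: mp; rewrite m1 => /prim_expr_order; rewrite expr1 => /eqP.
rewrite eq_complex /= => /andP[/eqP c1 /eqP s0].
have [p2|p2] := eqVneq p 2%N.
  move: c1; rewrite p2 mulrAC divff ?mul1r ?pnatr_eq0 // cospi; lra.
have p3 : (2 < p)%N by rewrite ltn_neqAle eq_sym p2 prime_gt1.
have : 0 < sin (2 * pi / p%:R) :> R.
  apply: sin_gt0_pi; apply/andP; split.
    by rewrite divr_gt0 ?mulr_gt0 ?pi_gt0 ?ltr0n ?prime_gt0.
  rewrite ltr_pdivrMr ?ltr0n ?prime_gt0 // mulrC ltr_pM2l ?pi_gt0 //.
  by rewrite ltr_nat.
by rewrite s0 ltxx.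
Qed.

Lemma phase_prim : (if p == 2%N then 4%N else p).-primitive_root (phase R p).
Proof.
rewrite /phase; case: eqP => [p2|_]; last exact: omega_prim.
have i2 : (Complex 0 1 : R[i]) ^+ 2 = -1.
  rewrite expr2; apply/eqP; rewrite eq_complex /=.
  by apply/andP; split; apply/eqP; ring.
have i4 : (Complex 0 1 : R[i]) ^+ 4 = 1.
  by rewrite (exprM _ 2 2) i2 sqrrN expr1n.
have [m mp m4] := prim_order_exists (isT : (0 < 4)%N) i4.
have : (m \in divisors 4) by rewrite -dvdn_divisors.
have n1 : (-1 : R[i]) != 1.
  by rewrite eq_sym -subr_eq0 opprK -(natrD _ 1 1) pnatr_eq0.
rewrite !inE => /or3P[]/eqP e; move: mp; rewrite e // => mp.
  by case/eqP: n1; rewrite -i2 (exprM _ 1 2) (prim_expr_order mp) expr1n.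
by case/eqP: n1; rewrite -i2 (prim_expr_order mp).
Qed.
End RootsOfUnity.

Section AdditiveCharacter.
Variables (R : realType) (F : finFieldType).
Let p := field_char F.
Let r := logn p #|F|.

Lemma field_char_pchar : p \in [pchar F].
Proof.
have [p' pp' pF] := finPcharP F.
suff -> : p = p' by [].
have n0 : (0 < logn p' #|F|)%N.
  by rewrite -(ltn_exp2l _ _ (prime_gt1 pp')) -card_pprimeChar finNzRing_gt1.
have e : #|F| = (p' ^ (logn p' #|F|).-1.+1)%N.
  by rewrite prednK //; exact: card_pprimeChar pF.
by rewrite /p /field_char e pdiv_pfactor.
Qed.

Lemma field_char_prime : prime p.
Proof. exact: pcharf_prime field_char_pchar. Qed.

Lemma card_field_char : #|F| = (p ^ r)%N.
Proof. exact: card_pprimeChar field_char_pchar. Qed.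

Lemma logn_card_gt0 : (0 < r)%N.
Proof.
rewrite -(ltn_exp2l _ _ (prime_gt1 field_char_prime)) -card_field_char.
exact: finNzRing_gt1.
Qed.

Lemma exprD_char i (x y : F) : (x + y) ^+ (p ^ i) = x ^+ (p ^ i) + y ^+ (p ^ i).
Proof.
apply: (@exprD_prime_power _ _ r); rewrite ?logn_card_gt0 ?card_field_char //.
by exists p, 1%N; rewrite field_char_prime.
Qed.

Lemma abs_traceD (x y : F) : abs_trace (x + y) = abs_trace x + abs_trace y.
Proof. by rewrite -big_split; apply: eq_bigr => i _; rewrite exprD_char. Qed.

Lemma abs_trace0 : abs_trace (0 : F) = 0.
Proof. by apply: (addIr (abs_trace (0 : F))); rewrite -abs_traceD !add0r. Qed.

Lemma abs_trace_Frobenius (x : F) : abs_trace x ^+ p = abs_trace x.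
Proof.
have D (y z : F) : (y + z) ^+ p = y ^+ p + z ^+ p.
  by rewrite -[p]expn1 exprD_char.
have Z : (0 : F) ^+ p = 0.
  by rewrite expr0n eqn0Ngt prime_gt0 // field_char_prime.
rewrite /abs_trace (big_morph _ D Z) -/p -/r.
under eq_bigr do rewrite -exprM -expnSr.
have e : x ^+ (p ^ r) = x by rewrite -card_field_char expf_card.
move: e; rewrite -(prednK logn_card_gt0) => e.
by rewrite big_ord_recr [RHS]big_ord_recl /= e addrC expr1.
Qed.

(** [X^p - X] is the product of the [X - k] for [k] in [F_p]; evaluated at [y], one factor
    vanishes. *)
Lemma prime_subfieldP (y : F) : y ^+ p = y -> exists k : 'I_p, k%:R = y.
Proof.
move=> yp; pose F' := pPrimeCharType field_char_pchar.
have pp := field_char_prime.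
have /(congr1 (map_poly (in_alg F'))) := finField_genPoly 'F_p.
rewrite rmorphB rmorph_prod /= map_polyXn map_polyX card_Fp //.
move=> /(congr1 (horner^~ (y : F'))).
rewrite !hornerE [X in X - _]yp subrr => /esym/eqP; rewrite horner_prod.
move=> /prodf_eq0[k _].
rewrite rmorphB /= map_polyX map_polyC /= !hornerE subr_eq0.
move=> /eqP yk.
have kp : (k < p)%N by rewrite -[X in (_ < X)%N](Fp_cast pp).
by exists (Ordinal kp); rewrite yk /= [RHS]mulr1.
Qed.

Lemma natr_inj_mod a b : a%:R = b%:R :> F -> a = b %[mod p].
Proof.
wlog ab : a b / (a <= b)%N => [H e|e].
  by case: (leqP a b) => [|/ltnW] ab; [apply: H | apply/esym/H].
apply/eqP; rewrite eq_sym eqn_mod_dvd // (dvdn_pcharf field_char_pchar).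
rewrite natrB //.
by rewrite e subrr.
Qed.

Lemma abs_trace_natP (x : F) :
  (abs_trace_nat x < p)%N /\ (abs_trace_nat x)%:R = abs_trace x.
Proof.
rewrite /abs_trace_nat; case: pickP => [k /eqP-> // | /= H].
by have [k /eqP e] := prime_subfieldP (abs_trace_Frobenius x); rewrite H in e.
Qed.

(** The trace is a polynomial function of degree at most [p ^ r.-1], which is less than [#|F|], and
    its coefficient of [X] is 1. *)
Lemma exists_abs_trace_neq0 : exists x : F, abs_trace x != 0.
Proof.
apply/existsP; apply: contraT => /existsPn H.
pose t : {poly F} := \sum_(i < r) 'X^(p ^ i).
have pp := field_char_prime.
have r1 := prednK logn_card_gt0.
have st : (size t <= (p ^ r.-1).+1)%N.
  apply: (leq_trans (size_sum _ _ _)); apply/bigmax_leqP => i _.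
  by rewrite size_polyXn ltnS leq_pexp2l ?prime_gt0 // -ltnS r1.
have t0 : t != 0.
  apply/eqP => /(congr1 (fun s : {poly F} => s`_1)); rewrite coef0 coef_sum.
  rewrite -r1 big_ord_recl /= big1 ?addr0 => [|i _]; last first.
    rewrite coefXn; case: eqP => // e.
    by have := ltn_expl (bump 0 i) (prime_gt1 pp); rewrite -e.
  by rewrite coefXn expn0 eqxx => /eqP; rewrite oner_eq0.
have /(max_poly_roots t0) : all (root t) (enum F).
  apply/allP => x _; rewrite rootE /t horner_sum.
  under eq_bigr do rewrite hornerXn.
  by rewrite -[_ == 0]negbK H.
rewrite enum_uniq -cardE => /(_ isT) /leq_trans /(_ st).
by rewrite ltnS leqNgt card_field_char ltn_exp2l ?prime_gt1 // -{2}r1 ltnSn.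
Qed.

(** The standard nontrivial additive character of [F]. *)
Definition chi (x : F) : R[i] := omega R p ^+ abs_trace_nat x.

Lemma chiE (x : F) k : k%:R = abs_trace x -> chi x = omega R p ^+ k.
Proof.
move=> kx; apply/eqP; rewrite (eq_prim_root_expr (omega_prim R field_char_prime)).
by apply/eqP/natr_inj_mod; rewrite kx; have [] := abs_trace_natP x.
Qed.

Lemma chiD (x y : F) : chi (x + y) = chi x * chi y.
Proof.
rewrite -exprD; apply: chiE.
rewrite natrD abs_traceD; have [_ ->] := abs_trace_natP x.
by have [_ ->] := abs_trace_natP y.
Qed.

Lemma chi0 : chi 0 = 1.
Proof. by rewrite (@chiE 0 0) ?abs_trace0. Qed.

Lemma chi_neq0 x : chi x != 0.
Proof.
apply/negP => /eqP x0; have := chiD x (- x).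
by rewrite subrr chi0 x0 mul0r => /eqP; rewrite oner_eq0.
Qed.

Lemma chi_expr x : chi x ^+ p = 1.
Proof.
by rewrite exprAC (prim_expr_order (omega_prim _ field_char_prime)) expr1n.
Qed.

Lemma chi_neq1 x : abs_trace x != 0 -> chi x != 1.
Proof.
move=> tx; have [lt e] := abs_trace_natP x.
apply/negP; rewrite /chi -(prim_order_dvd (omega_prim R field_char_prime)).
move/dvdnP=> [c ec]; case/negP: tx.
by rewrite -e ec natrM (pcharf0 field_char_pchar) mulr0.
Qed.

Lemma chi_conj x : (chi x)^* * chi x = 1.
Proof.
rewrite mulrC -normCK.
suff -> : `|chi x| = 1 by rewrite expr1n.
apply/eqP; rewrite -(@pexpr_eq1 _ _ p) ?normr_ge0 ?prime_gt0 ?field_char_prime //.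
by rewrite -normrX chi_expr normr1.
Qed.

End AdditiveCharacter.

(** * Error operators *)

Section DotProduct.
Variables (F : finFieldType) (N : nat).
Implicit Types a b c : 'rV[F]_N.

Lemma dotvDl a b c : dotv (a + b) c = dotv a c + dotv b c.
Proof.
by rewrite /dotv -big_split; apply: eq_bigr => i _; rewrite mxE mulrDl.
Qed.

Lemma dotvDr a b c : dotv a (b + c) = dotv a b + dotv a c.
Proof.
by rewrite /dotv -big_split; apply: eq_bigr => i _; rewrite mxE mulrDr.
Qed.

Lemma dotvC a b : dotv a b = dotv b a.
Proof. by apply: eq_bigr => i _; rewrite mulrC. Qed.

Lemma dotv0l a : dotv 0 a = 0.
Proof. by rewrite /dotv big1 // => i _; rewrite mxE mul0r. Qed.

Lemma dotv_surj b (s : F) : b != 0 -> exists a, dotv b a = s.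
Proof.
move=> /rV0Pn[i bi]; exists (\row_j (if j == i then s / b 0 i else 0)).
rewrite /dotv (bigD1 i) //= mxE eqxx mulrC divfK // big1 ?addr0 // => j ji.
by rewrite mxE (negPf ji) mulr0.
Qed.

Lemma sum_chi_dotv (R : realType) b : b != 0 -> \sum_x chi R (dotv b x) = 0.
Proof.
move=> b0; have [s s0] := exists_abs_trace_neq0 F.
have [a ab] := dotv_surj s b0.
have e : \sum_x chi R (dotv b x) = chi R s * \sum_x chi R (dotv b x).
  rewrite [LHS](reindex_inj (addrI a)) mulr_sumr; apply: eq_bigr => x _.
  by rewrite dotvDr ab chiD.
move/eqP: e; rewrite -{1}[\sum_x _]mul1r -subr_eq0 -mulrBl mulf_eq0 subr_eq0.
by rewrite eq_sym (negPf (chi_neq1 R s0)) => /eqP.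
Qed.

End DotProduct.

Section ErrorOperators.
Variables (R : realType) (F : finFieldType) (N : nat).
Local Notation V := (state_space R F N).
Implicit Types (a b : 'rV[F]_N) (u v : V).

Definition weyl a b : 'End(V) := (Xop R a \o Zop R b)%VF.

Lemma weylE a b v x : weyl a b v x = chi R (dotv b (x - a)) * v (x - a).
Proof. by rewrite comp_lfunE XopE ZopE !ffunE. Qed.

Lemma weyl0 v : weyl 0 0 v = v.
Proof. by apply/ffunP => x; rewrite weylE dotv0l chi0 mul1r subr0. Qed.

Lemma weylM a b a' b' v :
  weyl a b (weyl a' b' v) = chi R (dotv b a') *: weyl (a + a') (b + b') v.
Proof.
apply/ffunP => x; rewrite weylE weylE ffunE weylE opprD addrA.
have -> : dotv b (x - a) = dotv b a' + dotv b (x - a - a').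
  by rewrite -dotvDr [a' + _]addrC subrK.
by rewrite dotvDl !chiD /GRing.scale /= !mulrA.
Qed.

Lemma weyl_commute a b a' b' v :
  weyl a b (weyl a' b' v)
  = chi R (dotv b a' - dotv b' a) *: weyl a' b' (weyl a b v).
Proof. by rewrite !weylM scalerA -chiD subrK [a' + a]addrC [b' + b]addrC. Qed.

Lemma hdot_weyl a b u v : hdot (weyl a b u) (weyl a b v) = hdot u v.
Proof.
rewrite /hdot [RHS](reindex_inj (addIr (- a))); apply: eq_bigr => x _.
by rewrite !weylE rmorphM mulrACA chi_conj mul1r.
Qed.

Lemma hdotZr c u v : hdot u (c *: v) = c * hdot u v.
Proof.
by rewrite /hdot mulr_sumr; apply: eq_bigr => x _; rewrite ffunE mulrCA.
Qed.

Lemma hdotZl c u v : hdot (c *: u) v = c^* * hdot u v.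
Proof.
rewrite /hdot mulr_sumr; apply: eq_bigr => x _.
by rewrite ffunE [c *: u x]/(c * u x) rmorphM mulrA.
Qed.

Lemma hdotBr u v w : hdot u (v - w) = hdot u v - hdot u w.
Proof.
by rewrite /hdot -sumrB; apply: eq_bigr => x _; rewrite !ffunE mulrBr.
Qed.

Lemma error_opE c a b v :
  error_op R c a b v = phase R (field_char F) ^+ c *: weyl a b v.
Proof. by rewrite scale_lfunE. Qed.

(* By Fourier inversion over [b]. *)
Lemma hdot_weyl_eq0 u v :
  (forall a b, hdot u (weyl a b v) = 0) -> v != 0 -> u = 0.
Proof.
move=> H v0; have [y vy] : exists y, v y != 0.
  apply/existsP; apply: contraNT v0 => /existsPn v0; apply/eqP/ffunP => y.
  by rewrite ffunE; apply/eqP; rewrite -[_ == _]negbK v0.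
apply/ffunP => x; rewrite ffunE; apply/eqP; rewrite -conjC_eq0.
(* The shift by [a] brings the coordinate [y] of [v] to position [x]; the character sum over [b]
   isolates this term. *)
pose a := x - y.
have : \sum_b chi R (dotv b (- y)) * hdot u (weyl a b v) = 0.
  by apply: big1 => b _; rewrite H mulr0.
under eq_bigr do rewrite /hdot mulr_sumr.
rewrite exchange_big (bigD1 x) //= [X in _ + X]big1 => [|x' x'x]; last first.
  have xa0 : x' - a - y != 0 by rewrite /a opprB addrA addrAC addrK subr_eq0.
  transitivity (\sum_b chi R (dotv (x' - a - y) b) * ((u x')^* * v (x' - a))).
    apply: eq_bigr => b _; rewrite weylE.
    have -> : dotv (x' - a - y) b = dotv b (x' - a) + dotv b (- y).
      by rewrite -dotvDr dotvC.
    by rewrite chiD [LHS]mulrCA [RHS]mulrCA; congr (_ * _); rewrite mulrCA mulrA.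
  by rewrite -mulr_suml sum_chi_dotv // mul0r.
rewrite addr0 (eq_bigr (fun=> (u x)^* * v y)) => [|b _]; last first.
  rewrite weylE /a subKr mulrCA [chi _ _ * (chi _ _ * _)]mulrA -chiD -dotvDr.
  by rewrite addNr dotvC dotv0l chi0 mul1r.
rewrite sumr_const => /eqP.
rewrite mulrn_eq0 mulf_eq0 (negPf vy) orbF => /orP[|//].
by move=> /eqP/card0_eq/(_ 0).
Qed.


End ErrorOperators.

(** * Linear algebra *)

Section CommonEigenvector.
Import VectorInternalTheory.

Lemma common_eigenvector_lfun (C : numClosedFieldType) (V : vectType C)
    (I : finType) (f : I -> 'End(V)) :
  (0 < dim V)%N -> (forall i j v, f i (f j v) = f j (f i v)) ->
  exists2 v : V, v != 0 & forall i, exists lam, f i v = lam *: v.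
Proof.
move=> V0 fC; pose M i := f2mx (f i).
have fE i v : f i v = r2v (v2r v *m M i).
  by rewrite unlock.
have comm : {in codom M &, forall A B, comm_mx A B}.
  move=> _ _ /codomP[i ->] /codomP[j ->].
  rewrite /comm_mx; apply/row_matrixP => k.
  have := fC j i (r2v (delta_mx 0 k)).
  rewrite !fE !r2vK => /(can_inj r2vK).
  by rewrite !rowE !mulmxA.
have [w w0 /allP wP] := common_eigenvector V0 comm.
exists (r2v w).
  apply: contra w0 => /eqP /(congr1 (v2r)).
  rewrite r2vK => ->; by rewrite linear0.
move=> i; have /sub_rVP[lam e] := wP (M i) (codom_f M i).
by exists lam; rewrite fE r2vK e linearZ.
Qed.

End CommonEigenvector.

Definition basis_state (C : fieldType) (T : finType) (x : T) :
    {ffun T -> C^o} :=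
  [ffun y => (y == x)%:R].

Lemma basis_state_sum (C : fieldType) (T : finType) (v : {ffun T -> C^o}) :
  v = \sum_x v x *: basis_state C x.
Proof.
apply/ffunP => y; rewrite sum_ffunE (bigD1 y) //= !ffunE eqxx.
rewrite /GRing.scale /= mulr1 big1 ?addr0 // => x xy; rewrite !ffunE eq_sym (negPf xy).
by rewrite /GRing.scale /= mulr0.
Qed.

(** The right-hand side is the trace of [P]. After expanding [P v] in a basis of the image, each
    basis vector, being fixed by [P], contributes 1. *)
Lemma dim_limg_idempotent (C : fieldType) (T : finType)
    (P : 'End({ffun T -> C^o})) :
  (forall v, P (P v) = P v) ->
  (\dim (limg P))%:R = \sum_x P (basis_state C x) x :> C.
Proof.
move=> PP; pose X := vbasis (limg P).
have PX v : P v = \sum_i coord X i (P v) *: X`_i.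
  by apply: coord_vbasis; rewrite memv_img ?memvf.
have -> : \sum_x P (basis_state C x) x
   = \sum_(i < \dim (limg P)) coord X i (P (\sum_x X`_i x *: basis_state C x)).
  under eq_bigr => x _.
    rewrite PX sum_ffunE. over.
  rewrite exchange_big; apply: eq_bigr => i _ /=.
  rewrite !linear_sum; apply: eq_bigr => x _ /=.
  by rewrite !linearZ /= ffunE /GRing.scale /= mulrC.
rewrite (eq_bigr (fun=> 1)) ?sumr_const ?card_ord // => i _.
have Xi : X`_i \in limg P by rewrite vbasis_mem // mem_nth // size_tuple.
rewrite -basis_state_sum.
have -> : P X`_i = X`_i by have /memv_imgP[v _ ->] := Xi; rewrite PP.
by rewrite coord_free ?eqxx // (basis_free (vbasisP _)).
Qed.

(** * Stabilizer codes of isotropic spaces *)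

Section IsotropicStabilizer.
Variables (R : realType) (F : finFieldType) (N : nat) (G : finZmodType).
Variables (A B : G -> 'rV[F]_N).
Hypotheses (AD : {morph A : g h / g + h}) (BD : {morph B : g h / g + h}).
Hypothesis AB_inj : forall g, A g = 0 -> B g = 0 -> g = 0.
Hypothesis isotropic : forall g h, dotv (B g) (A h) = dotv (B h) (A g).
Local Notation V := (state_space R F N).
Local Notation p := (field_char F).
(* [W], and [E] and [P] below, are variables specified by equations instead of
   definitions: failed unifications would unfold the latter at great cost. *)
Variable W : G -> 'End(V).
Hypothesis WE : forall g, W g = weyl R (A g) (B g).

Let A0 : A 0 = 0. Proof. by apply: (addIr (A 0)); rewrite -AD !add0r. Qed.
Let B0 : B 0 = 0. Proof. by apply: (addIr (B 0)); rewrite -BD !add0r. Qed.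
Let AMn g k : A (g *+ k) = A g *+ k.
Proof. by elim: k => [|k IH]; rewrite ?A0 // !mulrS AD IH. Qed.
Let BMn g k : B (g *+ k) = B g *+ k.
Proof. by elim: k => [|k IH]; rewrite ?B0 // !mulrS BD IH. Qed.

Let W_comp g h v : W g (W h v) = chi R (dotv (B g) (A h)) *: W (g + h) v.
Proof. by rewrite !WE weylM AD BD. Qed.

(* The phases are the eigenvalues on a common eigenvector: this treats p = 2 like
   odd p, where halving the form would give an explicit formula. *)
Lemma exists_stabilizer_phases : exists2 lam : G -> R[i],
  lam 0 = 1 & forall g h, lam g * lam h = chi R (dotv (B g) (A h)) * lam (g + h).
Proof.
have V0 : (0 < dim V)%N.
  rewrite -dimvf lt0n dimv_eq0; apply/negP => /eqP V0.
  have : basis_state (R[i]) (0 : 'rV[F]_N) \in (0%VS : {vspace V}).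
    by rewrite -V0 memvf.
  rewrite memv0 => /eqP /(congr1 (fun f : V => f 0)) /eqP.
  by rewrite !ffunE eqxx oner_eq0.
have WC g h v : W g (W h v) = W h (W g v).
  by rewrite !W_comp isotropic [g + h]addrC.
have [v v0 /fin_all_exists[lam lamP]] := common_eigenvector_lfun V0 WC.
have scal_inj (x y : R[i]) : x *: v = y *: v -> x = y.
  move=> /eqP; rewrite -subr_eq0 -scalerBl scaler_eq0 (negPf v0) orbF.
  by rewrite subr_eq0 => /eqP.
exists lam.
  by apply: scal_inj; rewrite -lamP scale1r WE A0 B0 weyl0.
move=> g h; apply: scal_inj.
have := W_comp g h v; rewrite !lamP linearZ /= lamP !scalerA => <-.
by rewrite mulrC.
Qed.

Variable lam : G -> R[i].
Hypotheses (lam0 : lam 0 = 1)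
  (lamM : forall g h, lam g * lam h = chi R (dotv (B g) (A h)) * lam (g + h)).

Let lam_neq0 g : lam g != 0.
Proof.
apply/eqP => g0; have /eqP := lamM g (- g).
by rewrite g0 mul0r subrr lam0 mulr1 eq_sym (negPf (chi_neq0 _ _)).
Qed.

(** Passing from [k] to [k + 1] brings [k] more factors [chi], in total
    [0 + ... + (k - 1) = 'C(k, 2)]. *)
Let lam_expr g k :
  lam g ^+ k = chi R (dotv (B g) (A g)) ^+ 'C(k, 2) * lam (g *+ k).
Proof.
have dM x j : chi R (x *+ j) = chi R x ^+ j :> R[i].
  by elim: j => [|j IH]; rewrite ?chi0 // mulrS chiD IH exprS.
have dotM j : dotv (B g) (A g *+ j) = dotv (B g) (A g) *+ j.
  elim: j => [|j IH]; first by rewrite !mulr0n dotvC dotv0l.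
  by rewrite mulrS dotvDr IH -mulrS.
elim: k => [|k IH]; first by rewrite mulr0n lam0 !expr0 mulr1.
rewrite exprS IH mulrCA lamM -mulrS AMn dotM dM mulrA -exprD.
by rewrite binS bin1.
Qed.

(** As [g *+ p = 0], [lam g ^+ p] is a value of [chi] to the power ['C(p, 2)]. This exponent is a
    multiple of [p] for odd [p]; for [p = 2] it is 1, which gives [lam g ^+ 4 = 1], and the phase is
    [i]. *)
Lemma phase_root_of_unity g : exists c, (lam g)^-1 = phase R p ^+ c.
Proof.
have pp := field_char_prime F; have pF := field_char_pchar F.
have gp : g *+ p = 0.
  apply: AB_inj; rewrite ?AMn ?BMn; apply/rowP => i.
    by rewrite mulmxnE mxE -mulr_natr (pcharf0 pF) mulr0.
  by rewrite mulmxnE mxE -mulr_natr (pcharf0 pF) mulr0.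
have lamp : lam g ^+ (if p == 2%N then 4%N else p) = 1.
  have := lam_expr g p; rewrite gp lam0 mulr1; case: eqP => [p2|/eqP p2] e.
    have := chi_expr R (dotv (B g) (A g)); rewrite p2 => chi2.
    by rewrite p2 binn expr1 in e; rewrite (exprM _ 2 2) e.
  have p3 : (2 < p)%N by rewrite ltn_neqAle eq_sym p2 prime_gt1.
  have /dvdnP[c ec] : (p %| 'C(p, 2))%N by apply: prime_dvd_bin.
  by rewrite e ec mulnC exprM chi_expr expr1n.
have M_prim := phase_prim R pp.
have [|c ->] := prim_rootP M_prim (_ : (lam g)^-1 ^+ _ = 1); last by exists c.
by rewrite exprVn lamp invr1.
Qed.

Variable E : G -> 'End(V).
Hypothesis EE : forall g v, E g v = (lam g)^-1 *: W g v.

(** Division by [lam] cancels the cocycle [chi R (dotv (B g) (A h))]. *)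
Lemma stabilizer_op_comp g h v : E g (E h v) = E (g + h) v.
Proof.
rewrite !EE linearZ /= W_comp !scalerA; congr (_ *: _).
apply: (mulIf (lam_neq0 (g + h))); rewrite -[LHS]mulrA -lamM mulVf //.
by rewrite mulrACA !mulVf // mulr1.
Qed.

Lemma stabilizer_op0 v : E 0 v = v.
Proof. by rewrite EE lam0 invr1 scale1r WE A0 B0 weyl0. Qed.

Lemma stabilizer_opK g : cancel (E g) (E (- g)).
Proof. by move=> v; rewrite stabilizer_op_comp addNr stabilizer_op0. Qed.

Lemma abelian_stabilizer :
  abelian_error_subgroup (fun T : 'End(V) => exists g, T = E g).
Proof.
split.
- move=> _ [g ->]; have [c e] := phase_root_of_unity g.
  by exists c, (A g), (B g); apply/lfunP => v; rewrite EE WE e error_opE.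
- by exists 0; apply/lfunP => v; rewrite stabilizer_op0 id_lfunE.
- move=> _ _ [g ->] [h ->]; exists (g + h); apply/lfunP => v.
  by rewrite comp_lfunE stabilizer_op_comp.
- move=> _ [g ->]; exists (- g); apply/lfunP => v.
  have ker0 : lker (E g) == 0%VS.
    by apply/lker0P; exact: can_inj (stabilizer_opK g).
  apply: (lker0P ker0); rewrite lker0_lfunVK // stabilizer_op_comp subrr.
  by rewrite stabilizer_op0.
- move=> _ _ [g ->] [h ->]; apply/lfunP => v.
  by rewrite !comp_lfunE !stabilizer_op_comp addrC.
Qed.

Variable P : 'End(V).
Hypothesis PE : forall v, P v = (#|G|%:R)^-1 *: \sum_g E g v.

Let cardG_neq0 : (#|G|%:R : R[i]) != 0.
Proof. by rewrite pnatr_eq0 -lt0n; apply/card_gt0P; exists 0. Qed.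

Lemma stabilizer_op_proj g v : E g (P v) = P v.
Proof.
rewrite PE linearZ /= linear_sum; congr (_ *: _).
rewrite [RHS](reindex_inj (addrI g)); apply: eq_bigr => h _ /=.
by rewrite stabilizer_op_comp.
Qed.

Lemma stabilizer_proj_fixed v : (forall g, E g v = v) -> P v = v.
Proof.
move=> H; rewrite PE (eq_bigr (fun=> v)) // sumr_const.
by rewrite -[v *+ _]scaler_nat scalerA mulVf // scale1r.
Qed.

Local Notation C := (limg P).

Lemma stabilized_spaceP v : v \in C <-> (forall g, E g v = v).
Proof.
split=> [/memv_imgP[w _ ->] g|/stabilizer_proj_fixed <-].
  exact: stabilizer_op_proj.
by rewrite memv_img ?memvf.
Qed.

(** The dimension is the trace of [P], the average of the traces of the [E g], to which only [g = 0]
    contributes: if [A g != 0] the diagonal is 0, and if [A g = 0] it sums a nontrivial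
    character. *)
Lemma dim_stabilized_space : (\dim C * #|G| = #|F| ^ N)%N.
Proof.
have PP v : P (P v) = P v.
  by apply: stabilizer_proj_fixed => g; exact: stabilizer_op_proj.
apply/eqP; rewrite -(eqr_nat R[i]) natrM dim_limg_idempotent //.
have -> : \sum_x P (basis_state R[i] x) x
  = (#|G|%:R)^-1 * \sum_g \sum_x E g (basis_state R[i] x) x.
  rewrite exchange_big mulr_sumr; apply: eq_bigr => x _ /=.
  by rewrite PE ffunE sum_ffunE.
rewrite mulrAC mulVf // mul1r (bigD1 0) //= [X in _ + X]big1 ?addr0 => [|g g0].
  rewrite (eq_bigr (fun=> 1)) => [|x _];
    last by rewrite stabilizer_op0 ffunE eqxx.
  by rewrite sumr_const card_mx mul1n natrX.
have e x : E g (basis_state R[i] x) x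
    = (lam g)^-1 * (chi R (dotv (B g) (x - A g)) * (A g == 0)%:R).
  rewrite EE WE ffunE weylE ffunE; congr (_ * (_ * _%:R)).
  by rewrite subr_eq addrC -subr_eq subrr eq_sym.
under eq_bigr do rewrite e.
rewrite -mulr_sumr -mulr_suml.
have [Ag|Ag] := eqVneq (A g) 0; last by rewrite !mulr0.
have Bg : B g != 0 by apply: contra g0 => /eqP Bg; apply/eqP/AB_inj.
rewrite Ag; under eq_bigr do rewrite subr0.
by rewrite sum_chi_dotv // mul0r mulr0.
Qed.

Lemma stabilizer_code_stabilized_space : stabilizer_code C.
Proof.
split.
  rewrite -dimv_eq0 -lt0n; have := dim_stabilized_space.
  case: (\dim C) => // /esym/eqP; rewrite mul0n expn_eq0.
  by move=> /andP[/eqP/card0_eq/(_ 0)].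
exists (fun T => exists g, T = E g); split; first exact: abelian_stabilizer.
move=> v; split=> [/stabilized_spaceP H _ [g ->] //|H].
by apply/stabilized_spaceP => g; apply: H; exists g.
Qed.

(** The unitary [W g] acts on the code as a scalar of modulus 1. Applying it to both arguments and
    commuting it past the error multiplies the coefficient by a number other than 1. *)
Lemma hdot_stabilized_space a b g u v :
  chi R (dotv (B g) a - dotv b (A g)) != 1 ->
  u \in C -> v \in C -> hdot u (weyl R a b v) = 0.
Proof.
move=> cg /stabilized_spaceP Cu /stabilized_spaceP Cv.
have Wl w : (forall g, E g w = w) -> W g w = lam g *: w.
  by move=> /(_ g) {2}<-; rewrite EE scalerA mulfV // scale1r.
have conj_lam : (lam g)^* * lam g = 1.
  rewrite mulrC -normCK; suff -> : `|lam g| = 1 by rewrite expr1n.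
  have [c e] := phase_root_of_unity g.
  have M_prim := phase_prim R (field_char_prime F).
  have ph1 : `|phase R p| = 1.
    apply/eqP; rewrite -(pexpr_eq1 (prim_order_gt0 M_prim)) ?normr_ge0 //.
    by rewrite -normrX (prim_expr_order M_prim) normr1.
  by apply: invr_inj; rewrite -normfV e normrX ph1 expr1n invr1.
have h1 : hdot u (weyl R a b v)
     = chi R (dotv (B g) a - dotv b (A g)) * hdot u (weyl R a b v).
  rewrite -{1}(hdot_weyl (A g) (B g)) weyl_commute -!WE !Wl // linearZ /=.
  rewrite !hdotZr hdotZl [lam g * (_ * _)]mulrA [lam g * _]mulrC.
  by rewrite conj_lam mul1r.
move/eqP: h1; rewrite -{1}[hdot _ _]mul1r -subr_eq0 -mulrBl mulf_eq0 subr_eq0.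
by rewrite eq_sym (negPf cg) => /eqP.
Qed.

End IsotropicStabilizer.

(** * Minimum distance and parameters of the code *)

Section MinDistance.
Variables (R : realType) (F : finFieldType) (N : nat).
Local Notation V := (state_space R F N).
Variable C : {vspace V}.

Lemma hdot_eq0 (u : V) : hdot u u = 0 -> u = 0.
Proof.
have ge0 x : true -> 0 <= (u x)^* * u x by rewrite mulrC mul_conjC_ge0.
move=> /eqP; rewrite psumr_eq0 // => /allP u0; apply/ffunP => x; rewrite ffunE.
have := u0 x (mem_index_enum x); rewrite mulrC => /eqP/eqP.
by rewrite mul_conjC_eq0 => /eqP.
Qed.

Lemma exists_orthogonal_pair : (1 < \dim C)%N ->
  exists u v, [/\ u \in C, v \in C, u != 0, v != 0 & hdot u v = 0].
Proof.
move=> C1; have C0 : C != 0%VS by rewrite -dimv_eq0 -lt0n ltnW.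
pose u := vpick C; have uC : u \in C by exact: memv_pick.
have u0 : u != 0 by rewrite vpick0.
have /subvPn[w wC wu] : ~~ (C <= <[u]>)%VS.
  apply: contraL C1 => /dimvS; rewrite -leqNgt => /leq_trans; apply.
  by rewrite dim_vline leq_b1.
have uu : hdot u u != 0 by apply: contra u0 => /eqP/hdot_eq0 ->.
exists u, (w - (hdot u w / hdot u u) *: u); split=> //.
- by rewrite memvB ?memvZ.
- by apply: contra wu; rewrite subr_eq0 => /eqP ->; rewrite memvZ // memv_line.
- by rewrite hdotBr hdotZr divfK // subrr.
Qed.

(** For nonzero orthogonal [u] and [v] in the code, detecting all errors would make every
    [hdot u (weyl R a b v)] zero, against [hdot_weyl_eq0]. *)
Lemma exists_undetected : (1 < \dim C)%N ->
  exists a b, ~ detects C (error_op R 0 a b).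
Proof.
move=> /exists_orthogonal_pair[u [v [uC vC u0 v0 uv]]].
apply: boolp.contrapT => H; case/eqP: u0; apply: (hdot_weyl_eq0 _ v0) => a b.
have [lam E] : detects C (error_op R 0 a b).
  by apply: boolp.contrapT => nd; apply: H; exists a, b.
by have := E u v uC vC; rewrite error_opE expr0 scale1r uv mulr0.
Qed.

(** The minimum distance is the least weight of an undetected error; there is one because the
    dimension exceeds 1. *)
Lemma exists_min_distance d : (1 < \dim C)%N ->
    (forall c a b, (error_weight a b < d)%N -> detects C (error_op R c a b)) ->
  exists2 d', (d <= d')%N & min_distance C d'.
Proof.
move=> C1 det; pose undet e :=
  exists c a b, error_weight a b = e /\ ~ detects C (error_op R c a b).
have ex : exists e, boolp.asbool (undet e).
  have [a [b ab]] := exists_undetected C1.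
  by exists (error_weight a b); apply/boolp.asboolP; exists 0%N, a, b.
have [e /boolp.asboolP ue min_e] := ex_minnP ex; exists e.
  case: ue => c [a [b [<- nd]]]; rewrite leqNgt; apply/negP => lt.
  exact/nd/det.
split=> // c a b ab; apply: boolp.contrapT => nd.
have : (e <= error_weight a b)%N by apply/min_e/boolp.asboolP; exists c, a, b.
by rewrite leqNgt ab.
Qed.

End MinDistance.

(** Errors of weight 0 are scalars; for the other weights below [d], the trace hypothesis makes all
    matrix coefficients on the code 0. As [0 < K], the dimension exceeds 1 and the minimum distance
    exists. *)
Lemma isotropic_stabilizer_code_exists (R : realType) (F : finFieldType)
    (N K d : nat) (G : finZmodType) (A B : G -> 'rV[F]_N) :
    {morph A : g h / g + h} -> {morph B : g h / g + h} ->
    (forall g, A g = 0 -> B g = 0 -> g = 0) ->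
    (forall g h, dotv (B g) (A h) = dotv (B h) (A g)) ->
    (#|G| * #|F| ^ K = #|F| ^ N)%N -> (0 < K)%N ->
    (forall a b, (0 < error_weight a b < d)%N ->
      exists g, abs_trace (dotv (B g) a - dotv b (A g)) != 0) ->
  stabilizer_code_exists R F N K d.
Proof.
move=> AD BD AB_inj iso cardG K0 dual.
have WE g : weyl R (A g) (B g) = weyl R (A g) (B g) by [].
have [lam lam0 lamM] := exists_stabilizer_phases AD BD iso WE.
pose E g : 'End(state_space R F N) := (lam g)^-1 *: weyl R (A g) (B g).
have EE g v : E g v = (lam g)^-1 *: weyl R (A g) (B g) v by rewrite scale_lfunE.
pose P : 'End(state_space R F N) := (#|G|%:R)^-1 *: \sum_g E g.
have PE v : P v = (#|G|%:R)^-1 *: \sum_g E g v by rewrite scale_lfunE sum_lfunE.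
have dimC : \dim (limg P) = (#|F| ^ K)%N.
  have := dim_stabilized_space AD BD AB_inj WE lam0 lamM EE PE.
  rewrite -cardG mulnC => /eqP; rewrite eqn_pmul2l => [/eqP //|].
  by apply/card_gt0P; exists 0.
exists (limg P); split=> //.
  exact: (stabilizer_code_stabilized_space AD BD AB_inj WE lam0 lamM EE PE).
apply: exists_min_distance.
  by rewrite dimC -(exp1n K) ltn_exp2r // finNzRing_gt1.
move=> c a b; case: (posnP (error_weight a b)) => [w0 _|w0 wd].
  have w i : (a 0 i = 0) /\ (b 0 i = 0).
    have /setP/(_ i) := cards0_eq w0; rewrite !inE.
    by move=> /negbT; rewrite negb_or !negbK => /andP[/eqP -> /eqP ->].
  have a0 : a = 0 by apply/rowP => i; rewrite mxE; have [] := w i.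
  have b0 : b = 0 by apply/rowP => i; rewrite mxE; have [] := w i.
  exists (phase R (field_char F) ^+ c) => u v _ _.
  by rewrite error_opE a0 b0 weyl0 hdotZr.
have [|g /(chi_neq1 R) gn] := dual a b; first by rewrite w0.
exists 0 => u v uC vC; rewrite error_opE hdotZr mul0r.
have := hdot_stabilized_space AD BD AB_inj WE lam0 lamM EE PE gn uC vC.
by move=> ->; rewrite mulr0.
Qed.

Theorem corollary15 (R : realType) (q n t : nat) (L F : finFieldType)
    (hq : prime_power q) (hn : (0 < n)%N) (ht0 : (0 < t)%N) (htn : (t <= n)%N)
    (hL : #|L| = (q ^ (2 * n))%N) (hF : #|F| = (q ^ n)%N)
    (hroots : #|[set x : L | root (Tr_poly L q n t) x]|
              = (q ^ (2 * n - 1 - t) + q ^ (2 * n - 1))%N)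
    (tau : nat) (htau : tau%:Z <= A_bound q n t) :
  exists2 K : nat,
    (K%:Z = (q ^ (2 * n - 1 - t) + q ^ (2 * n - 1))%N%:Z - 2 * tau%:Z - 2) &
    stabilizer_code_exists R F
      (q ^ (2 * n - 1 - t) + q ^ (2 * n - 1))%N K (tau + 2)%N.
Proof.
have tn : (0 < t <= n)%N by rewrite ht0.
have := locus_size_gt (prime_power_gt1 hq) tn htau.
rewrite -(card_trace_locus hq hn ht0 htn hL htau hroots).
set Z := [set x : L | _] => ZK.
(* The isotropic space has [#|L| ^ (tau + 1) = #|F| ^ (2 * tau + 2)] elements, whose exponent is
   subtracted from the length. *)
exists (#|Z| - (2 * tau + 2))%N; first by lia.
have hLF : #|L| = (#|F| ^ 2)%N by rewrite hL hF -expnM mulnC.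
have Zk : (tau.+1 <= #|Z|)%N by lia.
have orth i j : (i < tau.+1)%N -> (j < tau.+1)%N ->
    \sum_(l < #|Z|) enum_val l ^+ (i + #|F| * j) = 0 :> L.
  rewrite hF !ltnS => hi hj.
  rewrite -(big_enum_val (fun x : L => x ^+ (i + q ^ n * j))).
  rewrite -[RHS](trace_locus_orthogonal hq hn ht0 htn hL htau hi hj).
  by apply: eq_bigl => x; rewrite inE.
have z_inj : injective (fun l : 'I_#|Z| => enum_val l) by exact: enum_val_inj.
have [A [B [AD BD AB_inj iso dual]]] :=
  hermitian_isotropic_family hLF z_inj Zk orth.
apply: (@isotropic_stabilizer_code_exists _ _ _ _ _ 'rV[L]_tau.+1
  A B AD BD AB_inj iso).
- by rewrite card_mx mul1n hLF -expnM -expnD; congr (_ ^ _)%N; lia.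
- lia.
move=> a b w; have [s s0] := exists_abs_trace_neq0 F.
have [|g e] := dual a b _ s; first lia.
by exists g; rewrite e.
Qed.
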